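(* There exist absolute constants $C,c>0$ and $n_0\in\mathbb{N}$ such that for every integer $n\ge n_0$ and every $\Delta\in\mathbb{N}$ with $\Delta\le c\sqrt{n}$, every $(n,C\Delta\sqrt{n})$-expander is $\mathcal{T}(n,\Delta)$-universal.
   Context: All graphs are finite and simple. For a graph $G$ and $X\subseteq V(G)$, $N_G(X)=\bigl(\bigcup_{v\in X}N_G(v)\bigr)\setminus X$, and $e_G(X,Y)$ is the number of edges between disjoint sets $X,Y$. Given $n\in\mathbb{N}$ and real $d>0$, an $n$-vertex graph $G$ is an $(n,d)$-expander if (i) $|N_G(X)|\ge d|X|$ for all $X\subseteq V(G)$ with $1\le |X|<\frac{n}{2d}$; and (ii) $e_G(X,Y)>0$ for all disjoint $X,Y\subseteq V(G)$ with $|X|=|Y|\ge\frac{n}{2d}$. $\mathcal{T}(n,\Delta)$ is the family of all $n$-vertex trees with maximum degree at most $\Delta$. A graph $G$ is $\mathcal{T}(n,\Delta)$-universal if it contains every $T\in\mathcal{T}(n,\Delta)$ as a (not necessarily induced) subgraph. *)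

(* Defs.v *)
From HB Require Import structures.
From mathcomp Require Import all_boot all_order all_algebra.
From mathcomp Require Import reals.

Set Implicit Arguments.
Unset Strict Implicit.
Unset Printing Implicit Defensive.

Import Order.TTheory GRing.Theory Num.Theory.

Record sgraph := SGraph {
  vertex :> finType;
  adj : rel vertex;
  adj_sym : symmetric adj;
  adj_irrefl : irreflexive adj
}.

Definition neighbours (G : sgraph) (v : G) : {set G} := [set u | adj v u].

Definition set_neighbours (G : sgraph) (X : {set G}) : {set G} :=
  (\bigcup_(v in X) neighbours v) :\: X.

(* Edges are counted as pairs (x, y) with x in X and y in Y; for disjoint X
   and Y, the only case used, each edge is counted exactly once. *)
Definition edges_between (G : sgraph) (X Y : {set G}) : nat :=
  #|[set p in setX X Y | adj p.1 p.2]|.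

Definition max_degree (G : sgraph) : nat := \max_(v : G) #|neighbours v|.

Definition connected_graph (G : sgraph) : Prop :=
  0 < #|G| /\ forall x y : G, connect (@adj G) x y.

(* [ucycle] also accepts the empty sequence and, in a symmetric relation,
   sequences x, y along a single edge, hence the bound on the size. *)
Definition acyclic_graph (G : sgraph) : Prop :=
  forall s : seq G, 2 < size s -> ~ ucycle (@adj G) s.

Definition is_tree (G : sgraph) : Prop := connected_graph G /\ acyclic_graph G.

Definition bounded_degree_trees (n Delta : nat) (T : sgraph) : Prop :=
  [/\ is_tree T, #|T| = n & max_degree T <= Delta].

(* G has a not necessarily induced subgraph isomorphic to H. *)
Definition contains_copy (G H : sgraph) : Prop :=
  exists2 f : H -> G, injective f & {homo f : x y / adj x y}.

Definition tree_universal (n Delta : nat) (G : sgraph) : Prop :=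
  forall T : sgraph, bounded_degree_trees n Delta T -> contains_copy G T.

Local Open Scope ring_scope.

Definition is_expander (R : realType) (n : nat) (d : R) (G : sgraph) : Prop :=
  [/\ 0 < d, #|G| = n,
      forall X : {set G}, (1 <= #|X|)%N -> #|X|%:R < n%:R / (2 * d) ->
        d * #|X|%:R <= #|set_neighbours X|%:R
    & forall X Y : {set G}, [disjoint X & Y] -> #|X| = #|Y| ->
        n%:R / (2 * d) <= #|X|%:R -> (0 < edges_between X Y)%N].

(* Main.v *)
Require Import Defs.
From mathcomp Require Import all_boot all_order all_algebra.
From mathcomp Require Import reals zify ring lra.

Import Order.TTheory GRing.Theory Num.Theory.

Set Implicit Arguments.
Unset Strict Implicit.
Unset Printing Implicit Defensive.

(* Let M be the least integer with M >= n / (2 d), so that two disjoint sets of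
   M vertices are always joined by an edge and (100 M Delta)^2 <= n.  As in the
   Friedman-Pippenger theorem, a tree is embedded vertex by vertex while every
   set X of at most 2M vertices keeps at least \sum_(x in X) f x unused
   neighbours, f x being the number of edges that x may still receive.  Since
   M * (M * Delta) is much smaller than n, demands f larger than M are affordable
   as long as a constant fraction of the graph is unused; growing stars with M
   leaves at two used vertices then connects them by a path of length 3, so that
   any few prescribed vertices can be incorporated into the embedding.

   If T has at least 20 M Delta leaves, split T at a vertex into two large parts
   and embed the part with more leaves, except for these leaves.  Less than M
   vertices expand badly into the images of the parents of the omitted leaves;
   they are used up by the other part.  By Hall's theorem the omitted leaves can
   be matched to the vertices remaining at the end.

   Otherwise T has a path of length 100 M Delta with inner vertices of degree 2.
   Build a path of gadgets, embed the rest of T, and match the remaining vertices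
   both to the ends a and to the ends b of the side paths of the gadgets.  This
   yields a path and some cycles; crossing one gadget in each cycle merges all of
   them into one path. *)

(** * Systems of demands *)

Section Demands.
Variables (I V : finType) (Gam : I -> {set V}).
Implicit Types (X Y : {set I}) (U L : {set V}) (f g : I -> nat).

Definition nbs X : {set V} := \bigcup_(i in X) Gam i.

(** The range [m.*2] contains the union of any two sets of size less than [m]; [good_extend] needs
    this for its tight sets. *)
Definition good m U f : Prop :=
  forall X, #|X| <= m.*2 -> \sum_(i in X) f i <= #|nbs X :\: U|.

Lemma nbsU X Y : nbs (X :|: Y) = nbs X :|: nbs Y.
Proof. exact: bigcup_setU. Qed.

Lemma nbs1 x : nbs [set x] = Gam x.
Proof. by rewrite /nbs big_set1. Qed.

Lemma nbs_sub X Y : X \subset Y -> nbs X \subset nbs Y.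
Proof. by move=> /setUidPr <-; rewrite nbsU subsetUl. Qed.

Lemma good_mono m U U' f f' :
  U' \subset U -> (forall i, f' i <= f i) -> good m U f -> good m U' f'.
Proof.
move=> sU le_f gf X leX; apply: leq_trans (leq_trans (gf X leX) _).
  exact: leq_sum.
by apply: subset_leq_card; apply: setDS.
Qed.

Lemma sum_setUI f X Y :
  \sum_(i in X :|: Y) f i + \sum_(i in X :&: Y) f i =
  \sum_(i in X) f i + \sum_(i in Y) f i.
Proof.
rewrite (big_setID X) /= setUK setDUl setDv set0U -addnA; congr (_ + _).
by rewrite addnC setIC -big_setID.
Qed.

Lemma sum_sub1 f x X :
  0 < f x -> \sum_(i in X) (f i - (i == x)) + (x \in X) = \sum_(i in X) f i.
Proof.
move=> fx; have [xX|xX] := boolP (x \in X).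
  rewrite !(bigD1 x xX) /= eqxx.
  rewrite (eq_bigr f) ?addn1; first lia.
  by move=> i /andP[_ /negPf ->]; rewrite subn0.
rewrite addn0; apply: eq_bigr => i iX.
by case: eqP => [ix|_]; rewrite ?subn0 //; rewrite -ix iX in xX.
Qed.

Lemma tightU m U f X Y :
    good m U f -> #|X :|: Y| <= m.*2 ->
    \sum_(i in X) f i = #|nbs X :\: U| -> \sum_(i in Y) f i = #|nbs Y :\: U| ->
  \sum_(i in X :|: Y) f i = #|nbs (X :|: Y) :\: U|.
Proof.
move=> gf leXY tX tY.
have gU := gf _ leXY.
have gI : \sum_(i in X :&: Y) f i <= #|nbs (X :&: Y) :\: U|.
  apply: gf; apply: leq_trans leXY; apply: subset_leq_card.
  by apply: subset_trans (subsetIl _ _) (subsetUl _ _).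
have eS := sum_setUI f X Y.
have sI : #|nbs (X :&: Y) :\: U| <= #|(nbs X :\: U) :&: (nbs Y :\: U)|.
  by apply: subset_leq_card; rewrite subsetI !setSD ?nbs_sub ?subsetIl ?subsetIr.
have := cardsUI (nbs X :\: U) (nbs Y :\: U).
rewrite -setDUl -nbsU; lia.
Qed.

(* Tight sets have size less than m, hence are closed under union.  If no choice
   of y works, the largest tight set avoiding x absorbs all of Gam x, and adding
   x to it violates the demands. *)
Lemma good_extend m U f x :
    good m U f ->
    (forall X, m <= #|X| <= m.*2 -> \sum_(i in X) f i < #|nbs X :\: U|) ->
    0 < f x ->
  exists y, [/\ y \in Gam x, y \notin U & good m (y |: U) (fun i => f i - (i == x))].
Proof.
move=> gf big fx.
pose tight X := [&& #|X| <= m.*2, x \notin X & \sum_(i in X) f i == #|nbs X :\: U|].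
have t0 : tight set0.
  rewrite /tight cards0 inE big_set0 /nbs big_set0 set0D cards0.
  by rewrite eqxx.
have [Z tZ maxZ] : exists2 Z : {set I}, tight Z & forall X, tight X -> #|X| <= #|Z|.
  by case: (arg_maxnP (fun X : {set I} => #|X|) t0) => Z tZ maxZ; exists Z.
have lt_m X : tight X -> #|X| < m.
  case/and3P=> leX _ /eqP eX; rewrite ltnNge; apply/negP => geX.
  by have := big X; rewrite geX leX eX ltnn => /(_ isT).
have subZ X : tight X -> X \subset Z.
  move=> tX; have ltX := lt_m _ tX; have ltZ := lt_m _ tZ.
  have /and3P[_ xX /eqP eX] := tX; have /and3P[_ xZ /eqP eZ] := tZ.
  have leU : #|X :|: Z| <= m.*2 by have := (leq_card_setU X Z).1; lia.
  have tU : tight (X :|: Z).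
    by rewrite /tight leU inE negb_or xX xZ (tightU gf) ?eqxx.
  have := maxZ _ tU; have : Z \subset X :|: Z by exact: subsetUr.
  by move=> s1 s2; have /eqP-> : Z == X :|: Z; rewrite ?eqEcard ?s1 ?subsetUl.
have [y yP|no] := pickP (fun y => [&& y \in Gam x, y \notin U &
   [forall X : {set I}, (#|X| <= m.*2) ==>
      (\sum_(i in X) (f i - (i == x)) <= #|nbs X :\: (y |: U)|)]]).
  have /and3P[yx yU /forallP gy] := yP.
  by exists y; split=> // X leX; have /implyP := gy X; apply.
have sub : Gam x :\: U \subset nbs Z.
  apply/subsetP => y; rewrite inE => /andP[yU yx].
  have := no y; rewrite yx yU /= => /negbT; rewrite negb_forall => /existsP[X].
  rewrite negb_imply -ltnNge => /andP[leX lt].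
  have gX := gf X leX; have eX := sum_sub1 X fx.
  have eC : #|nbs X :\: U| = (y \in nbs X) + #|nbs X :\: (y |: U)|.
    rewrite (cardsD1 y (nbs X :\: U)) inE yU /= setDDl; congr (_ + #|_ :\: _|).
    exact: setUC.
  have {lt} [xX yX tX] : [/\ x \notin X, y \in nbs X &
      \sum_(i in X) f i = #|nbs X :\: U|].
    move: lt gX eX eC.
    move: (\sum_(i in X) (f i - (i == x))) (\sum_(i in X) f i) => a b.
    by case: (x \in X); case: (y \in nbs X) => /=; split; lia.
  apply: subsetP yX; apply: nbs_sub; apply: subZ.
  by rewrite /tight leX xX tX eqxx.
have /and3P[_ xZ /eqP eZ] := tZ; have ltZ := lt_m _ tZ.
have : \sum_(i in x |: Z) f i <= #|nbs (x |: Z) :\: U|.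
  apply: gf; rewrite cardsU1 xZ; lia.
rewrite big_setU1 //= eZ nbsU nbs1 setDUl.
have -> : Gam x :\: U :|: nbs Z :\: U = nbs Z :\: U.
  apply/setUidPr/subsetP => y yx; rewrite inE (subsetP sub y yx) andbT.
  by move: yx; rewrite inE => /andP[].
lia.
Qed.

(* The strictness condition of [good_extend] is vacuous for sets of more than
   [#|I|] elements. *)
Lemma hall (A : {set I}) (y0 : V) :
    (forall X, X \subset A -> #|X| <= #|nbs X|) ->
  exists2 g : I -> V, {in A &, injective g} & {in A, forall i, g i \in Gam i}.
Proof.
move=> hA.
(* [J] is the part of [A] matched so far: its partners are used, and the demand is one exactly on
   [A :\: J]. *)
suff ext k : k <= #|A| -> exists (J : {set I}) (g : I -> V),
    [/\ J \subset A, #|J| = k, {in J &, injective g},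
        {in J, forall i, g i \in Gam i} &
        good #|I|.+1 [set g i | i in J] (fun i => i \in A :\: J)].
  have [J [g [sJ cJ injg gG _]]] := ext _ (leqnn _).
  have <- : J = A by apply/eqP; rewrite eqEcard sJ cJ /=.
  by exists g.
elim: k => [_|k IHk ltk].
  exists set0, (fun=> y0); rewrite cards0; split=> //; try by move=> i; rewrite inE.
    exact: sub0set.
  move=> X _; rewrite imset0 !setD0; apply: leq_trans (_ : #|X :&: A| <= _).
    rewrite -sum1_card big_mkcond [leqRHS]big_mkcond; apply: leq_sum => i _.
    by rewrite !inE; case: (i \in X); case: (i \in A).
  apply: leq_trans (hA _ (subsetIr _ _)) _.
  by apply: subset_leq_card; apply: nbs_sub; apply: subsetIl.
have [J [g [sJ cJ injg gG gd]]] := IHk (ltnW ltk).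
have [x] : exists x, x \in A :\: J.
  apply/set0Pn; rewrite -card_gt0.
  by have := cardsID J A; rewrite (setIidPr sJ); lia.
rewrite inE => /andP[xJ xA].
have [X| |y [yx yU gd']] := @good_extend _ _ _ x gd.
- by have := max_card X; move: #|X| => c; lia.
- by rewrite inE xJ xA.
have neq i : i \in J -> (i == x) = false by move=> iJ; apply: contraNF xJ => /eqP<-.
exists (x |: J), (fun i => if i == x then y else g i); split.
- by rewrite subUset sub1set xA.
- by rewrite cardsU1 xJ cJ.
- have ynot i : i \in J -> y <> g i.
    by move=> iJ e; rewrite e imset_f in yU.
  move=> i j; rewrite !inE => /predU1P[->|iJ] /predU1P[->|jJ] //; rewrite ?eqxx ?neq //.
  + by move=> /(ynot _ jJ).
  + by move/esym/(ynot _ iJ).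
  + exact: injg.
- by move=> i; rewrite !inE => /predU1P[->|iJ]; rewrite ?eqxx ?neq //; apply: gG.
apply: good_mono gd'.
  apply/subsetP => z /imsetP[i]; rewrite !inE => /predU1P[->|iJ] ->.
    by rewrite eqxx eqxx.
  by rewrite neq // imset_f ?orbT.
move=> i; rewrite !inE negb_or; by case: eqP => //= _; rewrite subn0.
Qed.

End Demands.

(** * Extending good systems in graphs where large sets are joined *)

Section Joined.
Variables (G : sgraph) (M : nat).

Definition joined : Prop := forall X Y : {set G}, [disjoint X & Y] ->
  M <= #|X| -> M <= #|Y| -> exists x y, [/\ x \in X, y \in Y & adj x y].

Implicit Types (X Y U L Z A : {set G}) (f : G -> nat).

Notation nbG := (nbs (@neighbours G)).
Notation goodG := (good (@neighbours G) M).

Lemma nbG_P X y : reflect (exists2 x, x \in X & adj x y) (y \in nbG X).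
Proof.
apply: (iffP bigcupP) => [[x xX]|[x xX xy]]; first by rewrite inE; exists x.
by exists x; rewrite // inE.
Qed.

Hypotheses (M_gt0 : 0 < M) (jG : joined).

Lemma few_unjoined X Y : [disjoint X & Y] -> M <= #|X| -> #|Y :\: nbG X| < M.
Proof.
move=> dXY leX; rewrite ltnNge; apply/negP => leY.
have dis : [disjoint X & Y :\: nbG X].
  by apply: disjointWr dXY; apply: subsetDl.
have [x [y [xX]]] := jG dis leX leY; rewrite inE => /andP[/negP yX _] xy.
by apply: yX; apply/nbG_P; exists x.
Qed.

(** All but fewer than [M] vertices outside [X] have a neighbour in [X]. This yields the strictness
    condition of [good_extend]. *)
Lemma large_nbs X U : M <= #|X| -> #|G| < #|nbG X :\: U| + #|U| + #|X| + M.
Proof.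
move=> leX; have dX : [disjoint X & ~: X] by rewrite -subsets_disjoint.
have lt := few_unjoined dX leX.
have := cardsC X.
have := cardsID (nbG X) (~: X).
have : #|~: X :&: nbG X| <= #|nbG X| by apply/subset_leq_card/subsetIr.
have := cardsID U (nbG X).
have : #|nbG X :&: U| <= #|U| by apply/subset_leq_card/subsetIr.
lia.
Qed.

Lemma leq_sum_const f d X : (forall v, f v <= d) -> \sum_(v in X) f v <= #|X| * d.
Proof. by move=> le; rewrite -sum_nat_const; apply: leq_sum. Qed.

Lemma good_leaf U f d x :
    goodG U f -> (forall v, f v <= d) -> #|U| + 2 * M * d + 3 * M <= #|G| ->
    0 < f x ->
  exists y, [/\ adj x y, y \notin U & goodG (y |: U) (fun v => f v - (v == x))].
Proof.
move=> gf fd room fx; have [X /andP[leX leX2]||y [yx yU gy]] := @good_extend _ _ _ M U f x gf.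
(* In [3 * M], the part [2 * M] accounts for [X] itself and [M] for the vertices not joined to it;
   [2 * M * d] bounds the demand of [X]. *)
- have := large_nbs U leX; have := leq_sum_const X fd; nia.
- exact: fx.
- by exists y; split=> //; move: yx; rewrite inE.
Qed.

Lemma good_star U f d x k :
    goodG U f -> (forall v, f v <= d) -> #|U| + k + 2 * M * d + 3 * M <= #|G| ->
    k <= f x ->
  exists L, [/\ L \subset neighbours x, [disjoint L & U], #|L| = k &
                goodG (L :|: U) (fun v => f v - (v == x) * k)].
Proof.
move=> gf fd; elim: k => [|k IH] room le_k.
  exists set0; rewrite cards0 sub0set; split=> //.
    by rewrite -setI_eq0 set0I.
  by rewrite set0U; apply: good_mono gf => // v; rewrite muln0 subn0.
have [||L [sL dL cL gL]] := IH; try lia.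
have fd' v : f v - (v == x) * k <= d by have := fd v; lia.
have cU : #|L :|: U| = k + #|U|.
  by have := cardsUI L U; rewrite (disjoint_setI0 dL) cards0 cL; lia.
have [||y [xy yU gy]] := good_leaf (x := x) gL fd'; first by rewrite cU; lia.
  by rewrite eqxx; lia.
move: (yU); rewrite inE negb_or => /andP[yL yU'].
exists (y |: L); split.
- by rewrite subUset sL sub1set inE xy.
- by rewrite -setI_eq0 setIUl (disjoint_setI0 dL) setU0 setI_eq0 disjoints1.
- by rewrite cardsU1 yL cL.
- rewrite -setUA; apply: good_mono gy => // v; lia.
Qed.

(* Freeing a set of neighbours of x pays for an equal increase of the demand of
   x. *)
Lemma good_free U f x L :
    goodG U f -> L \subset neighbours x -> L \subset U ->
  goodG (U :\: L) (fun v => f v + (v == x) * #|L|).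
Proof.
move=> gf sx sU X leX; have gX := gf X leX.
have -> : \sum_(v in X) (f v + (v == x) * #|L|) = \sum_(v in X) f v + (x \in X) * #|L|.
  rewrite big_split /=; congr (_ + _); have [xX|xX] := boolP (x \in X).
    rewrite (bigD1 x xX) /= eqxx big1 ?addn0 // => v /andP[_ /negPf->].
    by rewrite mul0n.
  rewrite big1 ?mul0n // => v vX; case: eqP => [e|_]; last by rewrite mul0n.
  by rewrite e (negPf xX) in vX.
have [xX|xX] := boolP (x \in X); last first.
  rewrite mul0n addn0; apply: leq_trans gX _; apply: subset_leq_card.
  by apply/setDS/subsetDl.
rewrite mul1n.
have LX : L \subset nbG X.
  apply/subsetP => y /(subsetP sx); rewrite inE => xy; apply/nbG_P.
  by exists x.
have sub : (nbG X :\: U) :|: L \subset nbG X :\: (U :\: L).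
  apply/subsetP => y; rewrite !inE => /orP[/andP[/negPf-> ->]|yL].
    by rewrite andbF.
  by rewrite yL (subsetP LX).
move: (subset_leq_card sub).
have := cardsUI (nbG X :\: U) L; have -> : (nbG X :\: U) :&: L = set0.
  apply/setP => y; rewrite !inE; apply/negP => /andP[/andP[yU _] yL].
  by rewrite (subsetP sU) in yU.
rewrite cards0; lia.
Qed.

(* Grow stars with M leaves at x and at y, join them by an edge, and free all
   other leaves. *)
Lemma good_link U f d x y :
    goodG U f -> (forall v, f v <= d) ->
    #|U| + 2 * M * d + 5 * M <= #|G| -> x != y -> M <= f x -> M <= f y ->
  exists p q, [/\ [&& adj x p, adj p q & adj q y], p \notin U, q \notin U, p != q &
    goodG (p |: (q |: U)) (fun v => f v - (v == x) - (v == y))].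
Proof.
move=> gf fd room xy fx fy.
have [||L [sL dL cL gL]] := good_star (k := M) (x := x) gf fd; [lia|exact: fx|].
have fd' v : f v - (v == x) * M <= d by have := fd v; lia.
have cU : #|L :|: U| = M + #|U|.
  by have := cardsUI L U; rewrite (disjoint_setI0 dL) cards0 cL; lia.
have [||L' [sL' dL' cL' gL']] := good_star (k := M) (x := y) gL fd'.
- by rewrite cU; lia.
- by rewrite eq_sym (negPf xy) mul0n subn0.
have dLL : [disjoint L & L'].
  by rewrite disjoint_sym; apply: disjointWr dL'; apply: subsetUl.
have [p [q [pL qL pq]]] := jG dLL (eq_leq (esym cL)) (eq_leq (esym cL')).
have pU : p \notin U by rewrite (disjointFr dL).
have qLU : q \notin L :|: U by rewrite (disjointFr dL').
have qU : q \notin U by apply: contra qLU; rewrite inE orbC => ->.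
have npq : p != q by apply: contraNneq qLU => <-; rewrite inE pL.
exists p, q; split=> //.
  have := subsetP sL _ pL; have := subsetP sL' _ qL; rewrite !inE => yq ->.
  by rewrite pq adj_sym.
have g1 := good_free gL' (subset_trans (subsetDl L' [set q]) sL')
  (subset_trans (subsetDl L' [set q]) (subsetUl _ _)).
have s2 : L :\: [set p] \subset (L' :|: (L :|: U)) :\: (L' :\: [set q]).
  apply/subsetP => z; rewrite !inE => /andP[zp zL].
  by rewrite zL orbT andbT (disjointFr dLL zL) andbF.
have g2 := good_free g1 (subset_trans (subsetDl L [set p]) sL) s2.
have := cardsD1 p L; have := cardsD1 q L'; rewrite pL qL => c2 c1.
apply: good_mono g2.
  apply/subsetP => z; rewrite !inE => /or3P[/eqP->|/eqP->|zU].
  - by rewrite eqxx pL (disjointFr dLL pL) /= andbF.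
  - by rewrite eqxx qL (disjointFl dLL qL) /= andbF.
  - have zL' : z \in L' = false by rewrite (disjointFl dL') // inE zU orbT.
    by rewrite zU (disjointFl dL zU) zL' !andbF.
(* Each end has paid [M] for its star and gets [M.-1] back. *)
move=> v; have e1 : #|L :\ p| = M.-1 by rewrite -cL c1.
have e2 : #|L' :\ q| = M.-1 by rewrite -cL' c2.
rewrite e1 e2; clear - M_gt0 xy; have [->|_] := eqVneq v x; first by rewrite (negPf xy) /=; lia.
have [->|_] := eqVneq v y; first by rewrite /=; lia.
by rewrite !mul0n !subn0 !addn0.
Qed.

Lemma good_reserve U f Z k : #|Z| <= k -> goodG U f -> goodG (U :|: Z) (fun v => f v - k).
Proof.
move=> leZ gf X leX; have [->|[x xX]] := set_0Vmem X; first by rewrite big_set0.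
have gX := gf X leX.
have c1 := cardsID Z (nbG X :\: U).
have c2 := subset_leq_card (subsetIr (nbG X :\: U) Z).
have [/exists_inP[z zX kz]|no] := boolP [exists z in X, k <= f z].
  have : \sum_(v in X) (f v - k) + k <= \sum_(v in X) f v.
    rewrite !(bigD1 z zX) -addnA [_ + k]addnC addnA subnK // leq_add2l.
    by apply: leq_sum => v _; apply: leq_subr.
  rewrite -setDDl; lia.
rewrite big1 // => v vX; apply/eqP; rewrite subn_eq0.
by move/exists_inPn: no => /(_ v vX); rewrite -ltnNge => /ltnW.
Qed.

End Joined.

(** * Initial systems, exceptional vertices and the final matching *)

Section Matching.
Variables (G : sgraph) (M : nat).
Implicit Types (X Y U L Z A W : {set G}) (f : G -> nat).

Notation nbG := (nbs (@neighbours G)).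
Notation goodG := (good (@neighbours G) M).

Hypotheses (M_gt0 : 0 < M) (jG : joined G M).

(** Sets of fewer than [M] vertices meet their demands by expansion, the surplus [e - d] absorbing
    the used vertices; larger sets do so by [large_nbs]. *)
Lemma good_init U e d :
    (forall X, 0 < #|X| < M -> e * #|X| <= #|set_neighbours X|) ->
    #|U| + d <= e -> #|U| + 2 * M * d + 3 * M <= #|G| -> goodG U (fun=> d).
Proof.
move=> expand le_e room X leX; rewrite sum_nat_const.
have [/eqP|X0] := posnP #|X|; first by rewrite cards_eq0 => /eqP->; rewrite cards0.
have [ltX|geX] := ltnP #|X| M; last by have := large_nbs M_gt0 jG U geX; nia.
have := expand X; rewrite X0 ltX => /(_ isT).
have : #|set_neighbours X| <= #|nbG X| by apply/subset_leq_card/subsetDl.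
have := cardsID U (nbG X).
have := subset_leq_card (subsetIr (nbG X) U).
nia.
Qed.

(* Z is maximal among the sets of at most 2M vertices outside A that have at most
   #|Z| neighbours in A. *)
Lemma exceptional_set A : 3 * M <= #|A| ->
  exists2 Z : {set G}, #|Z| < M & forall Y : {set G}, [disjoint Y & A] -> [disjoint Y & Z] ->
    #|Y| <= M -> #|Y| <= #|nbG Y :&: A|.
Proof.
move=> leA.
pose bad (Z : {set G}) := [&& [disjoint Z & A], #|Z| <= M.*2 & #|nbG Z :&: A| <= #|Z|].
have b0 : bad set0.
  rewrite /bad cards0 -setI_eq0 set0I eqxx /=.
  by rewrite /nbs big_set0 set0I cards0.
have [Z bZ maxZ] : exists2 Z : {set G}, bad Z & forall X, bad X -> #|X| <= #|Z|.
  by case: (arg_maxnP (fun X : {set G} => #|X|) b0) => Z bZ maxZ; exists Z.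
have /and3P[dZ cZ nZ] := bZ.
have ltZ : #|Z| < M.
  (* With [M] or more vertices, [Z] would see all but fewer than [M] vertices of [A], that is, more
     than [2 * M] of them. *)
  rewrite ltnNge; apply/negP => geZ.
  have := few_unjoined jG dZ geZ; have := cardsID (nbG Z) A.
  rewrite setIC; lia.
exists Z => // Y dYA dYZ cY; rewrite leqNgt; apply/negP => lt.
have cU : #|Z :|: Y| = #|Z| + #|Y|.
  by have := cardsUI Z Y; rewrite (disjoint_setI0 _) 1?disjoint_sym // cards0; lia.
(* A violating [Y] could be added to [Z], against maximality. *)
have bU : bad (Z :|: Y).
  apply/and3P; split; last 1 first.
  - rewrite nbsU setIUl cU.
    have := (leq_card_setU (nbG Z :&: A) (nbG Y :&: A)).1; lia.
  - by rewrite -setI_eq0 setIUl (disjoint_setI0 dZ) (disjoint_setI0 dYA) setU0.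
  - by rewrite cU; lia.
by have := maxZ _ bU; rewrite cU; lia.
Qed.

Lemma card_fibres (J K : finType) (a : J -> K) (S : {set J}) :
  #|S| = \sum_(p in a @: S) #|[set x in S | a x == p]|.
Proof.
rewrite -sum1_card (partition_big a (mem (a @: S))) /=.
  apply: eq_bigr => p _; rewrite -sum1_card; apply: eq_bigl => x.
  by rewrite inE.
by move=> x xS; apply: imset_f.
Qed.

(** Hall's condition for a set [X] of items with anchors [a x]: for at most [M] anchors it follows
    from the demands. Otherwise fewer than [M] vertices of [W] see no anchor of [X]; by the last
    hypothesis they have as many neighbours in [a @: L], all of them anchors of items outside [X],
    so at most [#|L :\: X|] vertices of [W] are missed. *)
Lemma hall_leftover (J : finType) (L : {set J}) (a : J -> G) W f (y0 : G) :
    #|W| = #|L| -> {in L, forall x, a x \notin W} ->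
    goodG (~: W) f -> (forall p, #|[set x in L | a x == p]| <= f p) ->
    (forall Y, Y \subset W -> #|Y| <= M -> #|Y| <= #|nbG Y :&: a @: L|) ->
  exists2 g : J -> G, {in L &, injective g} &
    {in L, forall x, g x \in W /\ adj (a x) (g x)}.
Proof.
move=> cW aW gf demand back.
have nbE (X : {set J}) :
    nbs (fun x => neighbours (a x) :&: W) X = nbG (a @: X) :&: W.
  apply/setP => y; rewrite inE; apply/bigcupP/andP => [[x xX]|[/nbG_P[_ /imsetP[x xX ->] xy] yW]].
    rewrite !inE => /andP[xy yW]; split=> //; apply/nbG_P.
    by exists (a x); rewrite ?imset_f.
  by exists x; rewrite // !inE xy.
have [|g injg gP] := @hall _ _ (fun x => neighbours (a x) :&: W) L y0; last first.
  exists g => // x xL; have := gP x xL; rewrite !inE => /andP[-> ->]; by [].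
move=> X sX; rewrite nbE.
have [small|large] := leqP #|a @: X| M.
  have leX2 : #|a @: X| <= M.*2 by lia.
  have := gf _ leX2; rewrite setDE setCK; apply: leq_trans.
  rewrite (card_fibres a X); apply: leq_sum => p _; apply: leq_trans (demand p).
  apply: subset_leq_card; apply/subsetP => x; rewrite !inE => /andP[xX ->].
  by rewrite (subsetP sX).
have dW : [disjoint a @: X & W].
  rewrite disjoints_subset; apply/subsetP => _ /imsetP[x xX ->].
  by rewrite inE aW // (subsetP sX).
have lt := few_unjoined jG dW (ltnW large).
set Y := W :\: nbG (a @: X) in lt.
have := back Y (subsetDl _ _) (ltnW lt).
have sub : nbG Y :&: a @: L \subset a @: (L :\: X).
  apply/subsetP => z /setIP[/nbG_P[y yY yz] /imsetP[x xL ex]].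
  rewrite ex imset_f // inE xL andbT; apply/negP => xX.
  move: yY; rewrite inE => /andP[/negP nY _]; apply: nY; apply/nbG_P.
  by exists (a x); rewrite ?imset_f // -ex adj_sym.
have := subset_leq_card sub; have := leq_imset_card a (L :\: X).
have := cardsID X L; rewrite (setIidPr sX).
have := cardsID (nbG (a @: X)) W; rewrite -/Y [W :&: _]setIC.
lia.
Qed.

End Matching.

(** * Trees *)

(** The height [h] may be any function that decreases along [par], and the value [par r] is
    arbitrary. *)
Definition rooted (T : sgraph) (r : T) (par : T -> T) (h : T -> nat) : Prop :=
  [/\ forall x, x != r -> adj x (par x), forall x, x != r -> h (par x) < h x &
      forall x y, adj x y -> (x != r /\ par x = y) \/ (y != r /\ par y = x)].

Section Rooting.
Variables (T : sgraph) (r : T).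
Hypothesis treeT : is_tree T.

Let walk n (x : T) := [exists p : n.-tuple T, path (@adj T) x p && (last x p == r)].

Let ex_walk x : exists n, walk n x.
Proof.
have [[_ conT] _] := treeT; have /connectP[p pp lp] := conT x r.
by exists (size p); apply/existsP; exists (in_tuple p); rewrite pp -lp eqxx.
Qed.

(** This is the distance from [x] to [r]. *)
Let h x := ex_minn (ex_walk x).

Let h_min x p : path (@adj T) x p -> last x p = r -> h x <= size p.
Proof.
move=> pp lp; rewrite /h; case: ex_minnP => m _; apply.
by apply/existsP; exists (in_tuple p); rewrite pp lp eqxx.
Qed.

Let h_path x : exists p, [/\ path (@adj T) x p, last x p = r & size p = h x].
Proof.
rewrite /h; case: ex_minnP => m /existsP[p /andP[pp /eqP lp]] _.
by exists p; rewrite size_tuple.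
Qed.

Let lower x : x != r -> exists2 y, adj x y & h y < h x.
Proof.
have [[|y p] [/= pp lp sp]] := h_path x; first by rewrite lp eqxx.
case/andP: pp => xy pp _; exists y => //; rewrite -sp ltnS; exact: h_min.
Qed.

(* Two such neighbours would be joined, through r, by a path avoiding x, giving
   a cycle. *)
Let upper_unique x y1 y2 :
  adj x y1 -> h y1 <= h x -> adj x y2 -> h y2 <= h x -> y1 = y2.
Proof.
pose e : rel T := fun a b => [&& adj a b, a != x & b != x].
have e_sym : connect_sym e.
  by apply: sym_connect_sym => a b; rewrite /e adj_sym [(a != x) && _]andbC.
have epath y p : path (@adj T) y p -> x \notin y :: p -> path e y p.
  elim: p y => //= z p IH y /andP[yz pp]; rewrite !inE !negb_or => /and3P[xy xz xp].
  by rewrite /e yz eq_sym xy eq_sym xz IH // inE negb_or xz.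
have con y : adj x y -> h y <= h x -> connect e y r.
  move=> xy le; have [p [pp lp sp]] := h_path y.
  apply/connectP; exists p => //; apply: epath => //.
  rewrite inE negb_or; apply/andP; split.
    by apply: contraTneq xy => ->; rewrite adj_irrefl.
  (* A shortest walk from [y] through [x] would bring [x] to [r] in fewer than [h y <= h x]
     steps. *)
  apply/negP => xp; case/splitPr: xp pp lp sp => p1 p2.
  rewrite cat_path last_cat size_cat /= => /and3P[_ _ p2p] lp sp.
  have := h_min p2p lp; lia.
move=> a1 l1 a2 l2; apply/eqP/negPn/negP => neq.
have : connect e y1 y2.
  by apply: connect_trans (con _ a1 l1) _; rewrite e_sym con.
case/connectP => p pp l2'; case/shortenP: pp l2' => q pq uq _ lq.
have [_ acy] := treeT; have := acy [:: x, y1 & q].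
have szq : 0 < size q by case: q {pq uq} lq => // e2; rewrite /= in e2; rewrite e2 eqxx in neq.
have uxq : uniq [:: x, y1 & q].
  have xy1 : x != y1 by apply: contraTneq a1 => ->; rewrite adj_irrefl.
  rewrite cons_uniq uq inE negb_or xy1 andbT /=.
  elim: q y1 pq {uq lq szq a1 l1 neq xy1} => //= z q IH y1.
  by case/andP => /and3P[_ _ zx] /IH; rewrite inE negb_or eq_sym zx.
rewrite /= ltnS ltnS szq => /(_ isT); apply.
have sub : subrel e (@adj T) by move=> a b /and3P[].
by rewrite /ucycle uxq /= a1 rcons_path (sub_path sub pq) -lq adj_sym a2.
Qed.

Let par x := if [pick y | adj x y && (h y < h x)] is Some y then y else x.

(** By [upper_unique], [par x] is the only neighbour of [x] of height at most [h x]. So every edge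
    leads from one of its ends to the parent of that end. *)
Lemma tree_rooted : exists (p : T -> T) (d : T -> nat), rooted r p d.
Proof.
have parP x : x != r -> adj x (par x) && (h (par x) < h x).
  move=> /lower[y xy lt]; rewrite /par; case: pickP => [z //|/(_ y)].
  by rewrite xy lt.
have hr : h r = 0 by apply/eqP; rewrite -leqn0; apply: (h_min (p := [::])).
have h0 y : h y = 0 -> y = r.
  by move=> e; have [[|z p] [_ lp sp]] := h_path y; rewrite ?e in sp.
have up x y : adj x y -> h y <= h x -> x != r /\ par x = y.
  move=> xy le; have xr : x != r.
    apply: contraTneq xy => e; rewrite e hr leqn0 in le.
    by rewrite (h0 y (eqP le)) e adj_irrefl.
  split=> //; have /andP[a lt] := parP x xr.
  by apply: (upper_unique a) => //; apply: ltnW.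
exists par, h; split=> [x /parP/andP[]//|x /parP/andP[]//|x y xy].
have [le|/ltnW le] := leqP (h y) (h x); first by left; apply: up.
by right; apply: up => //; rewrite adj_sym.
Qed.

End Rooting.

Lemma copy_of_rooted (G T : sgraph) (r : T) par h (F : T -> G) :
  rooted r par h -> injective F -> (forall x, x != r -> adj (F x) (F (par x))) ->
  contains_copy G T.
Proof.
move=> [_ _ edges] injF adjF; exists F => // x y /edges[[xr <-]|[yr <-]].
  exact: adjF.
by rewrite adj_sym adjF.
Qed.

(* The smallest set of the required size that is a union of components of
   T - v, over all v. *)
Lemma tree_split (T : sgraph) n : is_tree T -> #|T| = n -> 2 <= n ->
  exists (v : T) (X : {set T}), [/\ v \notin X,
    forall x y, x \in X -> adj x y -> y \in X \/ y = v,
    n <= 4 * #|X| & 2 * #|X| <= n].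
Proof.
move=> treeT cT n2.
pose closedp (q : T * {set T}) := [&& q.1 \notin q.2, n <= 4 * #|q.2| &
  [forall x in q.2, forall y, adj x y ==> (y \in q.2) || (y == q.1)]].
have closedI v (X : {set T}) : v \notin X -> n <= 4 * #|X| ->
    (forall x y, x \in X -> adj x y -> y != v -> y \in X) -> closedp (v, X).
  move=> vX szX cl; rewrite /closedp /= vX szX; apply/forall_inP => x xX.
  apply/forallP => y; apply/implyP => xy; case: (eqVneq y v) => [_|yv].
    by rewrite orbT.
  by rewrite (cl x).
have /card_gt0P[v0 _] : 0 < #|T| by rewrite cT; lia.
have c0 : closedp (v0, ~: [set v0]).
  apply: closedI; rewrite ?inE ?eqxx //; last by move=> x y _ _; rewrite !inE.
  by have := cardsC1 v0; rewrite cT; lia.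
have [[v X] cX minX] : exists2 q, closedp q & forall q', closedp q' -> #|q.2| <= #|q'.2|.
  by case: (arg_minnP (fun q : T * {set T} => #|q.2|) c0) => q cq minq; exists q.
have /and3P[/= vX szX /forall_inP clX] := cX.
have cl x y : x \in X -> adj x y -> y != v -> y \in X.
  by move=> xX xy yv; have /forallP/(_ y) := clX x xX; rewrite xy (negPf yv) orbF.
exists v, X; split=> //.
  by move=> x y xX xy; have [->|yv] := eqVneq y v; [right|left; exact: cl xy yv].
rewrite leqNgt; apply/negP => big.
have [par [h [parP hP edges]]] := tree_rooted v treeT.
have neqv x : x \in X -> x != v by move=> xX; apply: contraNneq vX => <-.
have /card_gt0P[x0 x0X] : 0 < #|X| by lia.
have [w wX minw] : exists2 w, w \in X & forall x, x \in X -> h w <= h x.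
  by case: (arg_minnP h x0X) => w wX minw; exists w.
have parw : par w = v.
  apply/eqP/negPn/negP => nv; have wv := neqv w wX.
  have := minw _ (cl w (par w) wX (parP w wv) nv); have := hP w wv; lia.
(* These are the steps to the parent, stopped at [v]: [connect e x w] says that [x] is [w] or one of
   its descendants. Here [w] is a child of [v]. *)
pose e : rel T := fun x y => (x != v) && (par x == y).
have conn_step x : x != w -> connect e x w -> connect e (par x) w.
  move=> xw /connectP[[|z p] /=]; first by move=> _ e0; rewrite e0 eqxx in xw.
  by case/andP => /andP[_ /eqP <-] pp lp; apply/connectP; exists p.
have step_conn y : y \in X -> connect e (par y) w -> connect e y w.
  move=> yX; apply: connect_trans; apply: connect1.
  by rewrite /e neqv ?eqxx.
have nvw : ~~ connect e v w.
  apply/negP => /connectP[[|z p] /=]; first by move=> _ e0; rewrite -e0 wX in vX.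
  by rewrite /e eqxx.
pose X1 := [set x in X | connect e x w]; pose X2 := X :\: X1.
have sub1 : X1 \subset X by apply/subsetP => x; rewrite inE => /andP[].
have cards : #|X1| + #|X2| = #|X|.
  by have := cardsID X1 X; rewrite (setIidPr sub1).
have w1 : w \in X1 by rewrite inE wX connect0.
have cl1 x y : x \in X1 -> adj x y -> y != v -> y \in X1.
  rewrite inE => /andP[xX cx] xy yv; rewrite inE (cl x y) //=.
  have [[xv py]|[_ py]] := edges x y xy; last first.
    by apply: (step_conn y (cl x y xX xy yv)); rewrite py.
  rewrite -py conn_step //; apply: contraNneq yv => xw.
  by rewrite -py xw parw.
have cl2 x y : x \in X2 -> adj x y -> y != v -> y \in X2.
  rewrite !inE => /andP[nx xX] xy yv; rewrite (cl x y) // !andbT.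
  rewrite xX /= in nx; apply: contra nx => cy.
  have [[xv py]|[_ py]] := edges x y xy; first by apply: (step_conn x xX); rewrite py.
  rewrite -py conn_step //; apply: contraNneq vX => yw.
  by rewrite -parw -yw py.
have v1 : v \notin X1 by apply: contra vX => /(subsetP sub1).
have v2 : v \notin X2 by apply: contra vX; rewrite inE => /andP[].
have c1 : 0 < #|X1| by apply/card_gt0P; exists w.
(* If all of [X] lies below [w], the pair [(w, X :\ w)] is smaller and still admissible, since
   [2 * #|X| > n >= 2]. *)
have [X20|X20] := posnP #|X2|.
  have wall x : x \in X -> connect e x w.
    move=> xX; have : x \notin X2 by move/eqP: X20; rewrite cards_eq0 => /eqP->; rewrite inE.
    by rewrite !inE xX /= andbT negbK.
  have cw : #|X| = #|X :\ w|.+1 by rewrite (cardsD1 w) wX.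
  have /minX /= : closedp (w, X :\ w).
    apply: closedI; first by rewrite !inE eqxx.
      by rewrite cw in big; clear -n2 big; lia.
    move=> x y; rewrite !inE => /andP[xw xX] xy yw; rewrite yw (cl x) //.
    apply: contraTneq (wall x xX) => yv.
    have [[xv py]|[]] := edges x y xy; last by rewrite yv eqxx.
    apply: contra nvw => /(conn_step _ xw); by rewrite py yv.
  by rewrite cw ltnn.
(* The larger part contains at least half of [X], hence more than a quarter of the tree. *)
have [le|le] : #|X| <= 2 * #|X1| \/ #|X| <= 2 * #|X2| by clear -cards; lia.
  have /minX /= : closedp (v, X1) by apply: closedI => //; clear -le big; lia.
  by clear -cards X20; lia.
have /minX /= : closedp (v, X2) by apply: closedI => //; clear -le big; lia.
by clear -cards c1; lia.
Qed.

(** * Long bare paths in trees with few leaves *)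

Section Chain.
Variables (T : sgraph) (r : T) (par : T -> T).

(** The root is left out because [par r] is arbitrary. *)
Definition children x : {set T} := [set c | (c != r) && (par c == x)].

Lemma sum_children : \sum_x #|children x| < #|T|.
Proof.
apply: (@leq_ltn_trans #|[set~ r]|); last by rewrite cardsC1 prednK //; apply/card_gt0P; exists r.
rewrite -sum1_card [leqRHS](partition_big par predT) //=; apply: leq_sum => x _.
by rewrite -sum1_card; apply: eq_leq; apply: eq_bigl => c; rewrite !inE.
Qed.

(** There are fewer children than vertices; each unary vertex accounts for one child, and each
    vertex that is neither unary nor childless for at least two. *)
Lemma card_nonunary :
  #|[set x | #|children x| != 1]| <= 2 * #|[set x | #|children x| == 0]|.
Proof.
set B := [set x | _]; set L := [set x | _ == 0].
have := sum_children; have := cardsC B.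
have sLB : L \subset B by apply/subsetP => x; rewrite !inE => /eqP->.
have := cardsID L B; rewrite (setIidPr sLB).
rewrite (bigID (mem B)) (bigID (mem L)) /=.
have -> : \sum_(i | (i \in B) && (i \in L)) #|children i| = 0.
  by rewrite big1 // => x; rewrite !inE => /andP[_ /eqP].
have : \sum_(i in B :\: L) 2 <= \sum_(i | (i \in B) && (i \notin L)) #|children i|.
  rewrite big_mkcond [leqRHS]big_mkcond; apply: leq_sum => x _.
  by rewrite !inE; case: #|children x| => [|[|]].
have : \sum_(i in ~: B) 1 <= \sum_(i | i \notin B) #|children i|.
  rewrite big_mkcond [leqRHS]big_mkcond; apply: leq_sum => x _.
  by rewrite !inE negbK; case: eqP => // ->.
rewrite !sum_nat_const; lia.
Qed.

(** Otherwise, descending along unary vertices, every [x] meets a non-unary vertex after fewer than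
    [K] steps. That vertex and the number of steps determine [x], by going back along [par], so
    [card_nonunary] bounds [#|T|]. *)
Lemma long_chain K :
    2 * #|[set x | #|children x| == 0]| * K < #|T| ->
  exists y : nat -> T, forall i, i < K -> children (y i) = [set y i.+1].
Proof.
move=> lt; pose c x := odflt x [pick z in children x].
pose unary x := #|children x| == 1.
have unaryP x : unary x -> children x = [set c x].
  move=> /cards1P[z ez]; rewrite /c; case: pickP => [z'|/(_ z)].
    by rewrite ez inE => /eqP->.
  by rewrite ez inE eqxx.
have [/existsP[x /forallP un]|no] := boolP [exists x, [forall i : 'I_K, unary (iter i c x)]].
  by exists (fun i => iter i c x) => i lti; have /unaryP := un (Ordinal lti).
have ex x : exists i, (i < K) && ~~ unary (iter i c x).
  have := no; rewrite negb_exists => /forallP/(_ x); rewrite negb_forall.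
  by case/existsP => i ui; exists i; rewrite ltn_ord.
pose i x := ex_minn (ex x).
have iP x : [/\ i x < K, ~~ unary (iter (i x) c x) & iter (i x) par (iter (i x) c x) = x].
  rewrite /i; case: ex_minnP => m /andP[ltm um] minm; split=> //.
  have : m <= m by []; elim: {-2}m => [//|k IHk] ltk.
  rewrite iterSr iterS; have un : unary (iter k c x).
    apply/negPn/negP => nu; have := minm k; rewrite nu andbT.
    by move=> /(_ (ltn_trans ltk ltm)); rewrite leqNgt ltk.
  have : c (iter k c x) \in children (iter k c x) by rewrite unaryP ?inE.
  by rewrite inE => /andP[_ /eqP->]; apply/IHk/ltnW.
pose g x : T * 'I_K := (iter (i x) c x, Ordinal (let: And3 lti _ _ := iP x in lti)).
have injg : injective g.
  move=> x x' [e1 e2]; have [_ _ <-] := iP x; have [_ _ <-] := iP x'.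
  by rewrite e1 e2.
have := card_nonunary; set B := [set x | _] => leB.
have sub : g @: [set: T] \subset setX B [set: 'I_K].
  apply/subsetP => _ /imsetP[x _ ->]; rewrite !inE andbT.
  by have [_ ? _] := iP x.
have := subset_leq_card sub; rewrite card_imset // cardsX !cardsT card_ord.
rewrite leqNgt => /negP; case; apply: leq_ltn_trans lt.
by rewrite leq_mul2r leB orbT.
Qed.

End Chain.

Lemma card_children_deg (T : sgraph) Delta r par h : max_degree T <= Delta ->
  rooted r par h -> forall x : T, #|children r par x| <= Delta.
Proof.
move=> degT [parP _ _] x; apply: leq_trans (leq_trans (leq_bigmax x) degT).
apply: subset_leq_card; apply/subsetP => c; rewrite !inE => /andP[cr /eqP <-].
by rewrite adj_sym parP.
Qed.

Definition leaves (T : sgraph) : {set T} := [set x | #|neighbours x| <= 1].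

(** The chain is found with respect to an arbitrary root; the tree is then rooted again at the upper
    end [y 0], so that the bare path starts at the root. *)
Lemma bare_path (T : sgraph) n K L :
    is_tree T -> #|T| = n -> #|leaves T| <= L -> 2 * L * K < n ->
  exists (r : T) par h (y : nat -> T), [/\ rooted r par h, y 0 = r,
    forall i, i < K -> y i.+1 != r /\ par (y i.+1) = y i &
    forall i c, 0 < i < K -> c != r -> par c = y i -> c = y i.+1].
Proof.
move=> treeT cT leL lt.
have /card_gt0P[r0 _] : 0 < #|T| by rewrite cT; apply: leq_ltn_trans lt.
have [par0 [h0 root0]] := tree_rooted r0 treeT; have [parP0 hP0 edges0] := root0.
have sub : [set x | #|children r0 par0 x| == 0] \subset leaves T.
  apply/subsetP => x; rewrite !inE => /eqP/cards0_eq e0.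
  rewrite -(cards1 (par0 x)); apply: subset_leq_card; apply/subsetP => z.
  rewrite !inE => /edges0[[_ ->]//|[zr pz]].
  by have : z \in children r0 par0 x; [rewrite inE zr pz eqxx|rewrite e0 inE].
have [|y yP] := long_chain (r := r0) (par := par0) (K := K).
  rewrite cT; apply: leq_ltn_trans lt; rewrite leq_mul2r leq_mul2l /=.
  by rewrite (leq_trans (subset_leq_card sub) leL) orbT.
have yc i : i < K -> y i.+1 != r0 /\ par0 (y i.+1) = y i.
  move=> lti; have : y i.+1 \in children r0 par0 (y i) by rewrite yP ?inE.
  by rewrite inE => /andP[-> /eqP].
have hinc i j : i < j -> j <= K -> h0 (y i) < h0 (y j).
  elim: j => // j IH; rewrite ltnS leq_eqVlt => /predU1P[->|ij] jK.
    by have [yr <-] := yc j jK; apply: hP0.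
  by apply: ltn_trans (IH ij (ltnW jK)) _; have [yr <-] := yc j jK; apply: hP0.
have [par [h root]] := tree_rooted (y 0) treeT; have [parP hP edges] := root.
have adjy i : i < K -> adj (y i) (y i.+1).
  by move=> lti; have [yr e] := yc i lti; rewrite -{1}e adj_sym parP0.
have yp i : i < K -> y i.+1 != y 0 /\ par (y i.+1) = y i.
  elim: i => [|i IH] lti; have [[n0 e]|//] := edges _ _ (adjy _ lti).
    by rewrite eqxx in n0.
  have [_ e'] := IH (ltnW lti); rewrite e' in e.
  by have := hinc i i.+2 (leqnSn _) lti; rewrite e ltnn.
(* Under the old root, [c] is a child of [y i], hence [y i.+1], or its parent, hence the previous
   vertex of the chain. The latter is the new parent of [y i], not a child. *)
exists (y 0), par, h, y; split=> // i c /andP[i0 iK] cr pc.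
have ac : adj c (y i) by rewrite -pc parP.
have [[c0 e]|[yr e]] := edges0 _ _ ac.
  by apply/set1P; rewrite -yP // inE c0 e eqxx.
case: i i0 iK pc yr e {ac} => // i _ iK pc yr e.
have [_ e1] := yc i (ltnW iK); have [yi0 e2] := yp i (ltnW iK).
have := hP _ cr; have := hP _ yi0; rewrite pc e2 -e1 e.
by move=> h1 h2; have := ltn_trans h1 h2; rewrite ltnn.
Qed.

(** * Growing a partial embedding of a tree *)

Section Growing.
Variables (G T : sgraph) (M Delta : nat) (r : T) (par : T -> T) (h : T -> nat).
Implicit Types (S : {set T}) (U E Z : {set G}) (phi : T -> G) (f : G -> nat).

Notation nbG := (nbs (@neighbours G)).
Notation goodG := (good (@neighbours G) M).

Hypotheses (M_gt0 : 0 < M) (jG : joined G M) (root : rooted r par h).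
Hypothesis deg_le : forall x, #|children r par x| <= Delta.

(* The number of edges of T still to be embedded at the vertex g of G. *)
Definition pend S phi g := #|[set c | [&& c \notin S, par c \in S & phi (par c) == g]]|.

Definition upd phi x y : T -> G := fun z => if z == x then y else phi z.

Lemma upd_same phi x y : upd phi x y x = y.
Proof. by rewrite /upd eqxx. Qed.

Lemma upd_other phi x y z : z != x -> upd phi x y z = phi z.
Proof. by rewrite /upd => /negPf->. Qed.

Lemma pend_new S phi x y : r \in S -> {in S, forall z, phi z != y} ->
  pend (x |: S) (upd phi x y) y <= Delta.
Proof.
move=> rS new; apply: leq_trans (deg_le x); apply: subset_leq_card.
apply/subsetP => c; rewrite !inE negb_or => /and3P[/andP[cx cS] pS].
rewrite /upd; case: (eqVneq (par c) x) pS => [-> _ _|px].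
  by rewrite andbT; apply: contraNneq cS => ->.
by move=> /= pS /eqP e; have := new _ pS; rewrite e eqxx.
Qed.

(** The edge from [x] to its parent stops pending at [phi (par x)], and the edges to the children of
    [x] become pending at [y] only. *)
Lemma pend_old S phi x y g : x \notin S -> par x \in S -> g != y ->
  pend (x |: S) (upd phi x y) g + (g == phi (par x)) <= pend S phi g.
Proof.
move=> xS pS gy; rewrite /pend (cardsD1 x [set c | [&& c \notin S, _ & _]]).
rewrite inE xS pS /= [phi _ == g]eq_sym addnC leq_add2l; apply: subset_leq_card.
apply/subsetP => c; rewrite !inE negb_or => /and3P[/andP[cx cS]].
rewrite cx cS /= /upd; case: (eqVneq (par c) x) => [_ _|_ /= -> //].
by rewrite eq_sym (negPf gy).
Qed.

(** Vertices are added by increasing height, so that parents come first. Each use of [good_leaf]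
    lowers a demand together with the number of pending edges there, so the surplus [base] survives.
    The map [phi0] may be non-injective: [S0] can then stand for a path whose true images are chosen
    later. *)
Lemma grow d base k S0 phi0 U0 f0 S1 :
    #|S1 :\: S0| = k -> S0 \subset S1 -> r \in S0 ->
    {in S1, forall x, x != r -> par x \in S1} ->
    {in S0, forall x, phi0 x \in U0} -> goodG U0 f0 -> (forall g, f0 g <= d) ->
    #|U0| + k + 2 * M * d + 3 * M <= #|G| ->
    (forall g, base + pend S0 phi0 g <= f0 g) ->
    (forall g, g \notin U0 -> base + Delta <= f0 g) ->
  exists phi f, [/\ {in S0, phi =1 phi0},
    {in S1 :\: S0, forall x, adj (phi x) (phi (par x)) /\ phi x \notin U0},
    {in S1 :\: S0 &, injective phi}, goodG (U0 :|: phi @: (S1 :\: S0)) f &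
    [/\ forall g, base + pend S1 phi g <= f g, forall g, f g <= f0 g &
        forall g, g \notin phi @: S1 -> f g = f0 g]].
Proof.
elim: k S0 phi0 U0 f0 => [|k IHk] S0 phi0 U0 f0 cS sS rS0 cl1 im0 g0 f0d room dem new.
  have eD : S1 :\: S0 = set0 by apply/eqP; rewrite -cards_eq0 cS.
  have eS : S1 = S0.
    by apply/eqP; rewrite eqEsubset sS andbT -setD_eq0 eD.
  exists phi0, f0; rewrite eD eS; split=> //; try by move=> x; rewrite inE.
  by rewrite imset0 setU0.
have [x xD minx] : exists2 x, x \in S1 :\: S0 & forall z, z \in S1 :\: S0 -> h x <= h z.
  have /card_gt0P[x0 x0D] : 0 < #|S1 :\: S0| by rewrite cS.
  by case: (arg_minnP h x0D) => x xD minx; exists x.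
move: (xD); rewrite inE => /andP[xS0 xS1].
have xr : x != r by apply: contraNneq xS0 => ->.
have [parP hP _] := root.
have pS0 : par x \in S0.
  apply/negPn/negP => nS; have := minx (par x); rewrite inE nS cl1 //.
  by move=> /(_ isT); rewrite leqNgt hP.
have fx : 0 < f0 (phi0 (par x)).
  apply: leq_trans (dem _); rewrite addn_gt0; apply/orP; right.
  by apply/card_gt0P; exists x; rewrite inE xS0 pS0 eqxx.
have [|y [xy yU gy]] := @good_leaf G M M_gt0 jG U0 f0 d _ g0 f0d _ fx.
  by apply: leq_trans room; rewrite leq_add2r leq_add2r leq_addr.
have neqy : {in S0, forall z, phi0 z != y}.
  by move=> z zS; apply: contraNneq yU => <-; apply: im0.
have ny : y != phi0 (par x) by rewrite eq_sym neqy.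
have upd0 z : z \in S0 -> upd phi0 x y z = phi0 z.
  by move=> zS; apply: upd_other; apply: contraNneq xS0 => <-.
have DE : S1 :\: (x |: S0) = (S1 :\: S0) :\ x by rewrite setUC setDDl.
have [||||||||||phi [f [eq0 new1 inj1 gf [dem1 le1 same1]]]] :=
  IHk (x |: S0) (upd phi0 x y) (y |: U0) (fun g => f0 g - (g == phi0 (par x))).
- by move: cS; rewrite DE (cardsD1 x) xD => -[].
- by rewrite subUset sub1set xS1.
- by rewrite inE rS0 orbT.
- exact: cl1.
- move=> z; rewrite !inE => /predU1P[->|zS]; first by rewrite upd_same eqxx.
  by rewrite upd0 // im0 ?orbT.
- exact: gy.
- by move=> g; apply: leq_trans (f0d g); apply: leq_subr.
- by apply: leq_trans room; rewrite cardsU1 yU !leq_add2r add1n addSnnS.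
- move=> g; have [->|gy'] := eqVneq g y.
    rewrite (negPf ny) subn0; apply: leq_trans (new y yU).
    by rewrite leq_add2l; apply: pend_new.
  have := pend_old phi0 xS0 pS0 gy'; have := dem g.
  by move: (nat_of_bool _) => b; clear; lia.
- move=> g; rewrite inE negb_or => /andP[_ gU].
  have -> : (g == phi0 (par x)) = false by apply: contraNF gU => /eqP->; apply: im0.
  by rewrite subn0 new.
have phix : phi x = y by rewrite eq0 ?upd_same // setU11.
have phi_old z : z \in S0 -> phi z = phi0 z.
  by move=> zS; rewrite eq0 ?upd0 // inE zS orbT.
have D1 z : z \in S1 :\: S0 -> z != x -> z \in S1 :\: (x |: S0).
  by move=> zD zx; rewrite DE in_setD1 zx.
have notU z : z \in S1 :\: S0 -> z != x -> (phi z \notin U0) && (phi z != y).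
  move=> zD zx; have [_] := new1 z (D1 z zD zx).
  by rewrite !inE negb_or andbC.
exists phi, f; split=> //.
- move=> z zD; have [->|zx] := eqVneq z x.
    by rewrite phix phi_old // adj_sym.
  have /andP[zU _] := notU z zD zx; split=> //.
  by have [] := new1 z (D1 z zD zx).
- move=> z z' zD z'D; have [->|zx] := eqVneq z x; have [->|z'x] := eqVneq z' x => //.
  + by rewrite phix => e; have /andP[_] := notU z' z'D z'x; rewrite -e eqxx.
  + by rewrite phix => e; have /andP[_] := notU z zD zx; rewrite e eqxx.
  + by apply: inj1; apply: D1.
- apply: good_mono gf => //; rewrite subUset; apply/andP; split.
    by apply/subsetP => u uU; rewrite !inE uU orbT.
  apply/subsetP => _ /imsetP[z zD ->]; have [->|zx] := eqVneq z x.
    by rewrite !inE phix eqxx.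
  by rewrite inE imset_f ?orbT //; apply: D1.
split=> // [g|g gS]; first by apply: leq_trans (le1 g) _; apply: leq_subr.
rewrite same1 //; case: eqP => [e|_]; last by rewrite subn0.
by case/negP: gS; rewrite e -phi_old // imset_f // (subsetP sS).
Qed.

End Growing.

(** * Injective partial embeddings with reserved vertices *)

Section Embedding.
Variables (G T : sgraph) (M Delta : nat) (r : T) (par : T -> T) (h : T -> nat).
Implicit Types (S Y B : {set T}) (U E Z : {set G}) (phi : T -> G) (f : G -> nat).

Notation nbG := (nbs (@neighbours G)).
Notation goodG := (good (@neighbours G) M).

Hypotheses (M_gt0 : 0 < M) (jG : joined G M) (root : rooted r par h).
Hypothesis deg_le : forall x, #|children r par x| <= Delta.

(* E is a set of vertices of G reserved for later use. *)
Record embedding d base S phi E f : Prop := Embedding {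
  emb_root : r \in S;
  emb_closed : {in S, forall x, x != r -> par x \in S};
  emb_inj : {in S &, injective phi};
  emb_adj : {in S, forall x, x != r -> adj (phi x) (phi (par x))};
  emb_disj : [disjoint phi @: S & E];
  emb_good : goodG (phi @: S :|: E) f;
  emb_le : forall g, f g <= d;
  emb_pend : forall g, base + pend par S phi g <= f g;
  emb_new : forall g, g \notin phi @: S -> base + Delta.+1 <= f g }.

Lemma pend_le S phi g : r \in S -> {in S &, injective phi} -> pend par S phi g <= Delta.
Proof.
move=> rS inj; rewrite /pend; set P := [set c | _].
have [->|[c]] := set_0Vmem P; first by rewrite cards0.
rewrite inE => /and3P[_ pcS /eqP ec]; apply: leq_trans (deg_le (par c)).
apply: subset_leq_card; apply/subsetP => c'; rewrite !inE => /and3P[c'S pS /eqP e].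
rewrite (inj _ _ pS pcS) ?e ?ec // eqxx andbT.
by apply: contraNneq c'S => ->.
Qed.

Lemma emb_start d base g0 : base + Delta.+1 <= d -> goodG [set g0] (fun=> d) ->
  embedding d base [set r] (fun=> g0) set0 (fun=> d).
Proof.
move=> le gd; have inj : {in [set r] &, injective (fun _ : T => g0)}.
  by move=> x y; rewrite !inE => /eqP-> /eqP->.
split=> //; try by move=> x; rewrite inE => /eqP->; rewrite eqxx.
- by rewrite inE.
- by rewrite disjoint_sym -setI_eq0 set0I.
- by rewrite setU0 imset_set1.
- move=> g; apply: leq_trans le; rewrite leq_add2l leqW //; apply: pend_le => //.
  by rewrite inE.
Qed.

(** The part [k] of the surplus demand pays for the reservation, by [good_reserve]. *)
Lemma emb_reserve d base k S phi f Z :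
    embedding d (base + k) S phi set0 f -> #|Z| <= k -> [disjoint phi @: S & Z] ->
  embedding d base S phi Z (fun g => f g - k).
Proof.
case=> rS cl inj adjS _ gf le pe new leZ dis; split=> //.
- by move: (good_reserve M_gt0 leZ gf); rewrite setU0.
- by move=> g; apply: leq_trans (le g); apply: leq_subr.
- by move=> g; have := pe g; clear; lia.
- by move=> g gS; have := new g gS; clear; lia.
Qed.

(** Once all links are made, demands above [Delta.+1] serve no purpose. Truncating them lowers the
    bound [d], and with it the number of free vertices that further growth requires. *)
Lemma emb_cut d base S phi E f :
    embedding d base S phi E f ->
  embedding Delta.+1 0 S phi E (fun g => minn (f g) Delta.+1).
Proof.
case=> rS cl inj adjS dis gf le pe new; split=> //.
- by apply: good_mono gf => // g; apply: geq_minl.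
- by move=> g; apply: geq_minr.
- move=> g; rewrite add0n leq_min (leqW (pend_le _ rS inj)) andbT.
  by apply: leq_trans (pe g); apply: leq_addl.
- move=> g gS; rewrite add0n leq_min leqnn andbT.
  by apply: leq_trans (new g gS); apply: leq_addl.
Qed.

Lemma emb_grow d base S phi E f S1 :
    embedding d base S phi E f -> S \subset S1 ->
    {in S1, forall x, x != r -> par x \in S1} ->
    #|S1| + #|E| + 2 * M * d + 3 * M <= #|G| ->
  exists phi' f', {in S, phi' =1 phi} /\ embedding d base S1 phi' E f'.
Proof.
case=> rS cl inj adjS dis gf le pe new sS cl1 room.
have [||||phi' [f' [eq0 new1 inj1 gf' [pe1 le1 same1]]]] :=
  grow M_gt0 jG root deg_le (base := base) (phi0 := phi) (erefl #|S1 :\: S|) sS rS cl1 _ gf le.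
- by move=> x xS; rewrite inE imset_f.
- apply: leq_trans room; rewrite !leq_add2r.
  have := (leq_card_setU (phi @: S) E).1; have := leq_imset_card phi S.
  have := cardsID S S1; rewrite (setIidPr sS).
  by clear; lia.
- exact: pe.
- by move=> g; rewrite inE negb_or => /andP[/new ? _]; apply: leq_trans (_ : base + Delta.+1 <= _); rewrite ?leq_add2l.
have im0 x : x \in S -> phi' x \in phi @: S :|: E.
  by move=> xS; rewrite eq0 // inE imset_f.
have inD x : x \in S1 -> x \notin S -> x \in S1 :\: S by move=> x1 xS; rewrite inE xS.
have sub : phi @: S \subset phi' @: S1.
  apply/subsetP => _ /imsetP[x xS ->]; rewrite -eq0 // imset_f //.
  exact: (subsetP sS).
exists phi', f'; split=> //; split=> //.
- exact: (subsetP sS).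
- move=> x y x1 y1; have [xS|xS] := boolP (x \in S); have [yS|yS] := boolP (y \in S).
  + by rewrite !eq0 //; apply: inj.
  + by move=> e; have [_ /negP[]] := new1 y (inD y y1 yS); rewrite -e; apply: im0.
  + by move=> e; have [_ /negP[]] := new1 x (inD x x1 xS); rewrite e; apply: im0.
  + by apply: inj1; apply: inD.
- move=> x x1 xr; have [xS|xS] := boolP (x \in S); last by have [] := new1 x (inD x x1 xS).
  by rewrite !eq0 ?adjS // cl.
- rewrite -setI_eq0; apply/eqP/setP => g; rewrite !inE; apply/negP.
  case/andP => /imsetP[x x1 ->] xE; have [xS|xS] := boolP (x \in S).
    by move/disjointFr: dis => /(_ (phi x)); rewrite imset_f // -eq0 // xE => /(_ isT).
  by have [_] := new1 x (inD x x1 xS); rewrite inE xE orbT.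
- apply: good_mono gf' => //; apply/subsetP => g; rewrite !inE => /orP[/imsetP[x x1 ->]|->].
    have [xS|xS] := boolP (x \in S); first by have := im0 x xS; rewrite inE => ->.
    by rewrite (imset_f phi' (inD x x1 xS)) orbT.
  by rewrite orbT.
- by move=> g; apply: leq_trans (le1 g) (le g).
- by move=> g gS; rewrite same1 //; apply: new; apply: contra gS => /(subsetP sub).
Qed.

(** A path of length 3 from the image of the great-grandparent of [x] to the prescribed vertex [z]
    receives the two tree vertices in between. The surplus [base >= M] affords the stars. The link
    takes one unit of demand from [z], which is why [emb_new] asks for [Delta.+1]. *)
Lemma emb_link d base S phi E f x z :
    embedding d base S phi E f -> M <= base -> z \in E ->
    #|S| + #|E| + 2 * M * d + 5 * M <= #|G| ->
    x \notin S -> par x \notin S -> par (par x) \notin S -> par (par (par x)) \in S ->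
  exists phi' f', [/\ {in S, phi' =1 phi}, phi' x = z &
    embedding d base (x |: (par x |: (par (par x) |: S))) phi' (E :\ z) f'].
Proof.
case=> rS cl inj adjS dis gf le pe new leM zE room xS pS qS tS.
have [parP hP _] := root.
set p := par x in pS qS tS *; set q := par p in qS tS *; set t := par q in tS *.
have xr : x != r by apply: contraNneq xS => ->.
have pr : p != r by apply: contraNneq pS => ->.
have qr : q != r by apply: contraNneq qS => ->.
have hx : h p < h x by apply: hP.
have hp : h q < h p by apply: hP.
have xp : x != p by apply: contraTneq hx => <-; rewrite ltnn.
have xq : x != q by apply: contraTneq hx => ->; rewrite -leqNgt ltnW.
have pq : p != q by apply: contraTneq hp => <-; rewrite ltnn.
have zS : z \notin phi @: S by rewrite (disjointFl dis).
have tz : phi t != z by apply: contraNneq zS => <-; apply: imset_f.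
have [|||q' [p' [/and3P[tq' q'p' p'z] q'U p'U q'p'n gf']]] :=
  good_link M_gt0 jG gf le _ tz.
- apply: leq_trans room; rewrite !leq_add2r.
  have := (leq_card_setU (phi @: S) E).1; have := leq_imset_card phi S.
  by clear; lia.
- by apply: leq_trans leM _; apply: leq_trans (pe _); apply: leq_addr.
- by apply: leq_trans leM _; apply: leq_trans (new _ zS); apply: leq_addr.
move: (q'U) (p'U); rewrite !inE !negb_or => /andP[q'S q'E] /andP[p'S p'E].
have q'z : q' != z by apply: contraNneq q'E => ->.
have p'z' : p' != z by apply: contraNneq p'E => ->.
pose phi1 := upd phi q q'; pose phi2 := upd phi1 p p'; pose phi3 := upd phi2 x z.
have neqS y v : y \notin phi @: S -> v \in S -> phi v != y.
  by move=> yS vS; apply: contraNneq yS => <-; apply: imset_f.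
have neq u v : u \notin S -> v \in S -> v != u by move=> uS vS; apply: contraNneq uS => <-.
have e1 v : v \in S -> phi1 v = phi v by move=> vS; rewrite /phi1 upd_other // neq.
have e2 v : v \in S -> phi2 v = phi v by move=> vS; rewrite /phi2 upd_other ?e1 // neq.
have e3 v : v \in S -> phi3 v = phi v by move=> vS; rewrite /phi3 upd_other ?e2 // neq.
have v1q : phi1 q = q' by apply: upd_same.
have v2p : phi2 p = p' by apply: upd_same.
have v2q : phi2 q = q' by rewrite /phi2 upd_other // eq_sym.
have v3x : phi3 x = z by apply: upd_same.
have v3p : phi3 p = p' by rewrite /phi3 upd_other // eq_sym.
have v3q : phi3 q = q' by rewrite /phi3 upd_other // eq_sym.
set S3 := x |: _.
have S3P (P : T -> Prop) : P x -> P p -> P q -> {in S, forall v, P v} -> {in S3, forall v, P v}.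
  by move=> Px Pp Pq PS v; rewrite !inE => /or4P[/eqP->|/eqP->|/eqP->|/PS].
have im3 : phi3 @: S3 = z |: (p' |: (q' |: phi @: S)).
  rewrite /S3 !imsetU1 v3x v3p v3q; do 3 congr (_ |: _).
  by apply: eq_in_imset => v /e3.
exists phi3, (fun g => f g - (g == phi t) - (g == z)); split=> //; split.
- by rewrite !inE rS !orbT.
- apply: (S3P (fun v => v != r -> par v \in S3)) => [_|_|_|v vS vr]; rewrite !inE -?/p -?/q -?/t ?eqxx ?orbT ?tS ?orbT //.
  by rewrite (cl v) ?orbT.
- have sym (a b : G) : a != b -> b <> a by move=> ab e; rewrite e eqxx in ab.
  have nS v y : v \in S -> y \notin phi @: S -> phi v <> y by move=> vS yS; apply/eqP/neqS.
  have aux u := S3P (fun w => phi3 u = phi3 w -> u = w).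
  have inj3 : {in S3, forall v, {in S3, forall w, phi3 v = phi3 w -> v = w}}; last first.
    by move=> v w vS wS; apply: inj3.
  apply: (S3P (fun v => {in S3, forall w, phi3 v = phi3 w -> v = w})); [| | |move=> v vS];
    cbv beta; apply: aux; rewrite ?v3x ?v3p ?v3q //.
  + by move=> e; case: (sym _ _ p'z').
  + by move=> e; case: (sym _ _ q'z).
  + by move=> w wS; rewrite e3 // => /esym/(nS w z wS zS).
  + by move/eqP; rewrite (negPf p'z').
  + by move/eqP; rewrite eq_sym (negPf q'p'n).
  + by move=> w wS; rewrite e3 // => /esym/(nS w p' wS p'S).
  + by move/eqP; rewrite (negPf q'z).
  + by move/eqP; rewrite (negPf q'p'n).
  + by move=> w wS; rewrite e3 // => /esym/(nS w q' wS q'S).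
  + by rewrite e3 // => /(nS v z vS zS).
  + by rewrite e3 // => /(nS v p' vS p'S).
  + by rewrite e3 // => /(nS v q' vS q'S).
  + by move=> w wS; rewrite !e3 //; apply: inj.
- apply: (S3P (fun v => v != r -> adj (phi3 v) (phi3 (par v)))); rewrite -?/p -?/q -?/t ?v3x ?v3p ?v3q ?(e3 t) //.
  + by rewrite adj_sym p'z.
  + by rewrite adj_sym q'p'.
  + by rewrite adj_sym tq'.
  + by move=> v vS vr; rewrite !e3 ?adjS // cl.
- rewrite im3 -setI_eq0; apply/eqP/setP => g; rewrite !inE; apply/negP.
  case/andP => /or4P[/eqP->|/eqP->|/eqP->|gS] /andP[gz gE].
  + by rewrite eqxx in gz.
  + by rewrite gE in p'E.
  + by rewrite gE in q'E.
  + by rewrite (disjointFr dis gS) in gE.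
- apply: good_mono gf' => //; rewrite im3; apply/subsetP => g; rewrite !inE.
  case/orP => [/or4P[/eqP->|->|->|->]|/andP[_ ->]]; rewrite ?zE ?orbT //.
- by move=> g; rewrite -subnDA; apply: leq_trans (le g); apply: leq_subr.
- move=> g.
  (* The three placements are treated one at a time: [d1], [d2], [d3] bound the pending edges at the
     new image, and [o1], [o2], [o3] compare all other vertices with the previous stage. *)
  have d1 : pend par (q |: S) phi1 q' <= Delta.
    by apply: (pend_new deg_le) => // v vS; apply: neqS.
  have o1 g' : g' != q' -> pend par (q |: S) phi1 g' + (g' == phi t) <= pend par S phi g'.
    by move=> gq; apply: pend_old.
  have d2 : pend par (p |: (q |: S)) phi2 p' <= Delta.
    apply: (pend_new deg_le); first by rewrite inE rS orbT.
    move=> v; rewrite !inE => /predU1P[->|vS]; first by rewrite v1q.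
    by rewrite e1 ?neqS.
  have o2 g' : g' != p' -> pend par (p |: (q |: S)) phi2 g' <= pend par (q |: S) phi1 g'.
    move=> gp; apply: leq_trans (pend_old phi1 (x := p) _ _ gp); rewrite ?leq_addr //.
      by rewrite !inE negb_or pq.
    by rewrite !inE -/q eqxx.
  have d3 : pend par S3 phi3 z <= Delta.
    apply: (pend_new deg_le); first by rewrite !inE rS !orbT.
    move=> v; rewrite !inE => /or3P[/eqP->|/eqP->|vS]; rewrite ?v2p ?v2q //.
    by rewrite e2 ?neqS.
  have o3 g' : g' != z -> pend par S3 phi3 g' <= pend par (p |: (q |: S)) phi2 g'.
    move=> gz; apply: leq_trans (pend_old phi2 (x := x) _ _ gz); rewrite ?leq_addr //.
      by rewrite !inE !negb_or xp xq.
    by rewrite !inE -/p eqxx.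
  have nq : base + Delta.+1 <= f q' by apply: new.
  have np : base + Delta.+1 <= f p' by apply: new.
  have nz : base + Delta.+1 <= f z by apply: new.
  have [->|gz] := eqVneq g z.
    by rewrite eq_sym (negPf tz) subn0; clear -d3 nz; lia.
  have {o3} o3 := o3 g gz; have [ep|gp] := eqVneq g p'.
    rewrite ep eq_sym (negPf (neqS _ _ p'S tS)) !subn0.
    by rewrite ep in o3; clear -d2 o3 np; lia.
  have {o2} o2 := o2 g gp; have [eq|gq] := eqVneq g q'.
    rewrite eq eq_sym (negPf (neqS _ _ q'S tS)) !subn0.
    by rewrite eq in o3 o2; clear -d1 o2 o3 nq; lia.
  have := pe g; have := o1 g gq; rewrite subn0.
  by move: (nat_of_bool _) => b; clear -o2 o3; lia.
- move=> g; rewrite im3 !inE !negb_or => /and4P[gz gp gq gS].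
  have -> : (g == phi t) = false by apply: contraNF gS => /eqP->; apply: imset_f.
  by rewrite (negPf gz) !subn0 new.
Qed.

End Embedding.

(** * Incorporating prescribed vertices into the embedding *)

Section Spots.
Variables (G T : sgraph) (M Delta : nat) (r : T) (par : T -> T) (h : T -> nat).
Implicit Types (S Y B : {set T}) (U E Z : {set G}) (phi : T -> G) (f : G -> nat).

Hypotheses (M_gt0 : 0 < M) (jG : joined G M) (root : rooted r par h).
Hypothesis deg_le : forall x, #|children r par x| <= Delta.

Notation embedding := (embedding M Delta r par).

Lemma card_children_set B :
  #|[set c | (c != r) && (par c \in B)]| <= #|B| * Delta.
Proof.
rewrite -sum1_card (partition_big par (mem B)) /=; last first.
  by move=> c; rewrite inE => /andP[].
rewrite -sum_nat_const; apply: leq_sum => x xB; apply: leq_trans (deg_le x).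
rewrite sum1dep_card; apply: subset_leq_card; apply/subsetP => c.
by rewrite !inE => /andP[/andP[-> _] ->].
Qed.

(** If there were no such [x], then [Y] would lie within two generations below [r |: (S :&: Y)],
    contrary to its size. The least height forces the great-grandparent into [S], as otherwise
    [par x] would be a lower choice. *)
Lemma deep_vertex S Y :
    r \in S -> {in Y, forall x, par x \in Y \/ par x = r} -> r \notin Y ->
    (#|S :&: Y| + 1) * (1 + Delta + Delta * Delta) < #|Y| ->
  exists x, [/\ x \in Y, par x \in Y, par (par x) \in Y,
    [/\ x \notin S, par x \notin S & par (par x) \notin S] & par (par (par x)) \in S].
Proof.
move=> rS clY rY lt.
pose deep x := [&& x \in Y, x \notin S, par x \notin S & par (par x) \notin S].
have stay x : x \in Y -> par x \notin S -> par x \in Y.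
  by move=> /clY[//|->]; rewrite rS.
have [x0 dx0] : exists x, deep x.
  apply/existsP; rewrite -[X in is_true X]negbK negb_exists; apply/negP => /forallP no.
  pose B := r |: (S :&: Y).
  pose ch (B : {set T}) := [set c | (c != r) && (par c \in B)].
  have sub : Y \subset B :|: (ch B :|: ch (ch B)).
    apply/subsetP => x xY; rewrite in_setU [X in _ || X]in_setU.
    have xr : x != r by apply: contraNneq rY => <-.
    have BP y : y \in S -> y \in Y \/ y = r -> y \in B.
      by move=> yS [yY|->]; rewrite !inE ?yS ?yY ?eqxx ?orbT.
    have [xS|xS] := boolP (x \in S); first by rewrite BP //; left.
    have [pS|pS] := boolP (par x \in S).
      by rewrite orbCA inE xr BP //; apply: clY.
    have pY := stay x xY pS; have pr : par x != r by apply: contraNneq rY => <-.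
    have [qS|qS] := boolP (par (par x) \in S).
      by rewrite orbA orbC inE xr inE pr BP //; apply: clY.
    by have := no x; rewrite /deep xY xS pS qS.
  have := subset_leq_card sub; rewrite leqNgt => /negP; apply; apply: leq_ltn_trans lt.
  have cB : #|B| <= #|S :&: Y| + 1 by rewrite cardsU1 addnC leq_add2l leq_b1.
  apply: (@leq_trans (#|B| * (1 + Delta + Delta * Delta))); last first.
    by rewrite leq_mul2r cB orbT.
  have h1 := (leq_card_setU B (ch B :|: ch (ch B))).1.
  have h2 := (leq_card_setU (ch B) (ch (ch B))).1.
  have h3 : #|ch B| <= #|B| * Delta := card_children_set B.
  have h4 : #|ch (ch B)| <= #|ch B| * Delta := card_children_set (ch B).
  apply: leq_trans h1 _; rewrite !mulnDr muln1 -addnA leq_add2l.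
  apply: leq_trans h2 _; apply: (leq_add h3); rewrite mulnA.
  by apply: leq_trans h4 _; rewrite leq_mul2r h3 orbT.
have [x dx minx] : exists2 x, deep x & forall z, deep z -> h x <= h z.
  by case: (arg_minnP h dx0) => x dx minx; exists x.
have /and4P[xY xS pS qS] := dx; have pY := stay x xY pS; have qY := stay _ pY qS.
exists x; split=> //; apply/negPn/negP => tS.
have := minx (par x); rewrite /deep pY pS qS tS => /(_ isT).
have [_ hP _] := root; rewrite leqNgt hP //; by apply: contraNneq rY => <-.
Qed.

(** Each link moves one vertex from [E] into the image and places three vertices of [Y], so
    [#|S :&: Y| + 3 * #|E|] never increases and [deep_vertex] remains applicable. *)
Lemma emb_spots d base s S phi E f Y :
    embedding d base S phi E f -> M <= base -> r \notin Y ->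
    {in Y, forall x, par x \in Y \/ par x = r} ->
    #|S| + 3 * #|E| + #|E| + 2 * M * d + 5 * M <= #|G| ->
    #|S :&: Y| + 3 * #|E| <= s ->
    (s + 1) * (1 + Delta + Delta * Delta) < #|Y| ->
  exists S' phi' f', [/\ S \subset S', S' \subset S :|: Y, {in S, phi' =1 phi},
    E \subset phi' @: S' & embedding d base S' phi' set0 f'].
Proof.
have [k] := ubnP #|E|; elim: k S phi E f => // k IHk S phi E f.
rewrite ltnS => leE emb leM rY clY room les lt.
have [E0|[z zE]] := set_0Vmem E.
  by move: emb; rewrite E0 => emb; exists S, phi, f; rewrite subsetUl sub0set.
have cE : #|E| = #|E :\ z|.+1 by rewrite (cardsD1 z) zE.
have rS := emb_root emb.
have [|x [xY pY qY [xS pS qS] tS]] := deep_vertex rS clY rY.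
  apply: leq_ltn_trans lt; rewrite leq_mul2r leq_add2r; apply/orP; right.
  by apply: leq_trans les; apply: leq_addr.
have [|phi1 [f1 [e1 ez emb1]]] :=
  emb_link M_gt0 jG root deg_le emb leM zE _ xS pS qS tS.
  apply: leq_trans room; rewrite !leq_add2r; apply: leq_addr.
set S1 := x |: _ in emb1.
have sub1 : S1 :\: S \subset [set x; par x; par (par x)].
  apply/subsetP => v; rewrite !inE => /andP[/negPf->].
  by rewrite orbF orbA.
have sS : S \subset S1 by apply/subsetP => v vS; rewrite !inE vS !orbT.
have c3 : #|S1 :\: S| <= 3.
  apply: leq_trans (subset_leq_card sub1) _.
  apply: leq_trans (leq_card_setU _ _).1 _; rewrite cards1 addn1 ltnS.
  by rewrite cards2; case: (_ != _).
have cS1 : #|S1| <= #|S| + 3.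
  by have := cardsID S S1; rewrite (setIidPr sS); clear -c3; lia.
have cS1Y : #|S1 :&: Y| <= #|S :&: Y| + 3.
  have sub2 : S1 :&: Y \subset (S :&: Y) :|: (S1 :\: S).
    by apply/subsetP => v; rewrite in_setU in_setI in_setD in_setI => /andP[-> ->]; case: (v \in S).
  have := subset_leq_card sub2; have := (leq_card_setU (S :&: Y) (S1 :\: S)).1.
  by clear -c3; lia.
have [||||S2 [phi2 [f2 [s12 s21 e2 im2 emb2]]]] := IHk S1 phi1 (E :\ z) f1 _ emb1 leM rY clY.
- by rewrite cE in leE.
- by apply: leq_trans room; rewrite !leq_add2r; rewrite cE; clear -cS1; lia.
- by apply: leq_trans les; rewrite cE; clear -cS1Y; lia.
- exact: lt.
exists S2, phi2, f2; split=> //.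
- exact: subset_trans s12.
- apply: subset_trans s21 _; rewrite subUset subsetUr andbT.
  apply/subsetP => v; rewrite in_setU; have [//|vS] := boolP (v \in S) => vS1.
  have := subsetP sub1 v; rewrite in_setD vS vS1 => /(_ isT).
  by rewrite !inE -orbA => /or3P[/eqP->|/eqP->|/eqP->].
- by move=> v vS; rewrite e2 ?e1 // (subsetP sS).
- apply/subsetP => u uE; have [->|uz] := eqVneq u z; last first.
    by apply: (subsetP im2); rewrite !inE uz.
  have xS1 : x \in S1 by rewrite setU11.
  by rewrite -ez -e2 // imset_f // (subsetP s12).
Qed.

End Spots.

(** * Gadgets *)

Section Gadgets.
Variable G : sgraph.

Record gadget := Gadget { gu1 : G; gu2 : G; gb : G; ga : G; gin : seq G }.

Definition gverts (g : gadget) : seq G := [:: gu1 g, gu2 g, gb g, ga g & gin g].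

(* The vertices of a gadget are covered by the paths u1 u2 and b .. a, and also
   by the paths u1 .. a and b u2. *)
Definition gok (g : gadget) : bool :=
  [&& adj (gu1 g) (gu2 g), adj (gb g) (gu2 g),
      path (@adj G) (gb g) (rcons (gin g) (ga g)) &
      path (@adj G) (gu1 g) (rcons (rev (gin g)) (ga g))].

Fixpoint gchain (e : G) (gs : seq gadget) : bool :=
  if gs is g :: gs' then [&& adj e (gu1 g), gok g & gchain (gu2 g) gs'] else true.

Definition gend (e : G) (gs : seq gadget) : G := last e (map gu2 gs).

Definition gall (gs : seq gadget) : seq G := flatten (map gverts gs).

Lemma gall_cons g gs : gall (g :: gs) = gverts g ++ gall gs.
Proof. by []. Qed.

Variable M : nat.
Hypotheses (M_gt0 : 0 < M) (jG : joined G M).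
Implicit Types (U P Z : {set G}) (f : G -> nat).

Notation nbG := (nbs (@neighbours G)).
Notation goodG := (good (@neighbours G) M).

(* P is the set of vertices placed so far, e the last one; U also contains
   vertices reserved for later. *)
Record ready c d U P f e : Prop := Ready {
  rd_good : goodG U f;
  rd_le : forall v, f v <= d;
  rd_ge : forall v, c <= f v;
  rd_end : c < f e;
  rd_mem : e \in P;
  rd_sub : P \subset U;
  rd_new : forall v, v \notin P -> c + 10 <= f v }.

Lemma ready_leaf c d U P f e : ready c d U P f e ->
    #|U| + 2 * M * d + 3 * M <= #|G| ->
  exists y f', [/\ adj e y, y \notin U & ready c d (y |: U) (y |: P) f' y].
Proof.
case=> gf le ge en eP sPU new room.
have fe : 0 < f e by apply: leq_ltn_trans en.
have [y [ey yU gy]] := good_leaf M_gt0 jG gf le room fe.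
exists y, (fun v => f v - (v == e)); split=> //; split=> //.
- by move=> v; apply: leq_trans (le v); apply: leq_subr.
- by move=> v; case: eqP => [->|_]; rewrite ?subn0 // subn1 -ltnS prednK.
- have yP : y \notin P by apply: contra yU; apply: (subsetP sPU).
  have := new y yP; case: (y == e); clear; lia.
- exact: setU11.
- exact: setUS.
- move=> v; rewrite !inE negb_or => /andP[_ vP]; case: eqP => [ev|_].
    by rewrite ev eP in vP.
  by rewrite subn0 new.
Qed.

Lemma ready_link c d U P f e z : ready c d U P f e -> M <= c ->
    #|U| + 2 * M * d + 5 * M <= #|G| -> z \in U -> z \notin P ->
  exists p q f', [/\ path (@adj G) e [:: p; q; z], p \notin U, q \notin U, p != q &
    ready c d (p |: (q |: U)) (z |: (p |: (q |: P))) f' z].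
Proof.
case=> gf le ge en eP sPU new leM room zU zP.
have ez : e != z by apply: contraNneq zP => <-.
have [||p [q [/and3P[ep pq qz] pU qU npq gpq]]] := good_link M_gt0 jG gf le room ez.
- exact: leq_trans leM (ge _).
- exact: leq_trans leM (ge _).
exists p, q, (fun v => f v - (v == e) - (v == z)); split=> //; first by rewrite /= ep pq qz.
split=> //.
- by move=> v; rewrite -subnDA; apply: leq_trans (le v); apply: leq_subr.
- move=> v; have [->|vz] := eqVneq v z; last first.
    by rewrite subn0; case: eqP => [->|_]; rewrite ?subn0 // subn1 -ltnS prednK // (leq_ltn_trans _ en).
  by have := new z zP; case: (z == e); clear; lia.
- by have := new z zP; rewrite eqxx; case: (z == e); clear; lia.
- exact: setU11.
- by rewrite subUset sub1set !inE zU !orbT /=; do 2!apply: setUS.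
- move=> v; rewrite !inE !negb_or => /and4P[vz _ _ vP].
  have -> : (v == e) = false by apply: contraNF vP => /eqP->.
  by rewrite (negPf vz) !subn0 new.
Qed.

(** The path [u1 u2 b u4] is grown leaf by leaf; a link from [u4] to [u1] gives [a] and [u6],
    another one from [u4] to [u6] gives [p] and [q]. As [a] is adjacent to both [u4] and [u6], the
    inner path [u4 p q u6] can be traversed in either direction before [a]. *)
Lemma ready_gadget c d U f e : ready c d U U f e -> M <= c ->
    #|U| + 6 + 2 * M * d + 5 * M <= #|G| ->
  exists g f', [/\ adj e (gu1 g), gok g, size (gin g) = 4,
    uniq (gverts g) /\ {in gverts g, forall v, v \notin U} &
    ready c d ([set v in gverts g] :|: U) ([set v in gverts g] :|: U) f' (gu2 g)].
Proof.
case=> gf le ge en eU _ new leM room.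
have sub1 (f' : G -> nat) (h : G -> nat) : (forall v, f' v <= d) -> forall v, f' v - h v <= d.
  by move=> l v; apply: leq_trans (l v); apply: leq_subr.
have [||u1 [eu1 u1U g1]] := good_leaf (x := e) M_gt0 jG gf le.
- by clear -room; lia.
- exact: leq_ltn_trans en.
have n1 := new u1 u1U; have le1 := sub1 f (fun v => v == e) le.
have c1 : #|u1 |: U| = #|U|.+1 by rewrite cardsU1 u1U.
have [||u2 [u12 u2U g2]] := good_leaf (x := u1) M_gt0 jG g1 le1.
- by rewrite c1; clear -room; lia.
- by case: (_ == _); clear -n1; lia.
move: (u2U); rewrite inE negb_or => /andP[_ /new n2]; have le2 := sub1 _ (fun v => v == u1) le1.
have c2 : #|u2 |: (u1 |: U)| = #|U|.+2 by rewrite cardsU1 u2U c1.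
have [||b [u2b bU g3]] := good_leaf (x := u2) M_gt0 jG g2 le2.
- by rewrite c2; clear -room; lia.
- by case: (_ == _); case: (_ == _); clear -n2; lia.
move: (bU); rewrite !inE !negb_or => /and3P[_ _ /new n3]; have le3 := sub1 _ (fun v => v == u2) le2.
have c3 : #|b |: (u2 |: (u1 |: U))| = #|U|.+3 by rewrite cardsU1 bU c2.
have [||u4 [bu4 u4U g4]] := good_leaf (x := b) M_gt0 jG g3 le3.
- by rewrite c3; clear -room; lia.
- by case: (_ == _); case: (_ == _); case: (_ == _); clear -n3; lia.
move: (u4U); rewrite !inE !negb_or => /and4P[u4b u4u2 u4u1 /new n4].
have le4 := sub1 _ (fun v => v == b) le3.
have c4 : #|u4 |: (b |: (u2 |: (u1 |: U)))| = #|U|.+4 by rewrite cardsU1 u4U c3.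
have [|||a [u6 [/and3P[u4a au6 u6u1] aU u6U au6n g5]]] :=
  good_link (x := u4) (y := u1) M_gt0 jG g4 le4 _ u4u1.
- by rewrite c4; clear -room; lia.
- by do ?case: (_ == _); clear -n4 leM; lia.
- by do ?case: (_ == _); clear -n1 leM; lia.
have n6 : c + 10 <= f u6.
  by apply: new; apply: contra u6U; rewrite !inE => ->; rewrite !orbT.
have le5 : forall v, f v - (v == e) - (v == u1) - (v == u2) - (v == b) - (v == u4) - (v == u1) <= d.
  by move=> v; rewrite -!subnDA; apply: leq_trans (le v); apply: leq_subr.
have c5 : #|a |: (u6 |: (u4 |: (b |: (u2 |: (u1 |: U)))))| = #|U| + 6.
  by rewrite cardsU1 in_setU1 negb_or au6n aU cardsU1 u6U c4; clear; lia.
have u4u6 : u4 != u6 by apply: contraNneq u6U => <-; rewrite setU11.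
have [|||p [q [/and3P[u4p pq qu6] pU qU npq g6]]] :=
  good_link (x := u4) (y := u6) M_gt0 jG g5 le5 _ u4u6.
- by rewrite c5; clear -room; lia.
- by do ?case: (_ == _); clear -n4 leM; lia.
- by do ?case: (_ == _); clear -n6 leM; lia.
pose g := Gadget u1 u2 b a [:: u4; p; q; u6].
have gE : [set v in gverts g] :|: U =
    p |: (q |: (a |: (u6 |: (u4 |: (b |: (u2 |: (u1 |: U))))))).
  apply/setP => v; rewrite /gverts /g /= !inE.
  by do 8 (case: (v == _); rewrite ?orbT //=).
(* The vertices are listed from last to first placed, in the order in which their newness is
   known. *)
pose ord := [:: p; q; a; u6; u4; b; u2; u1].
have perm_ord : perm_eq (gverts g) ord.
  by apply/permP => P; rewrite /gverts /ord /=; clear; lia.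
have [u_ord ordU] : uniq ord /\ all (fun v => v \notin U) ord.
  move: u1U u2U bU u4U aU u6U pU qU; rewrite !inE !negb_or.
  repeat match goal with
  | |- is_true (_ && _) -> _ => case/andP => ?
  | |- is_true _ -> _ => move=> ?
  end.
  by split; rewrite /ord /= ?inE ?negb_or; do ?[apply/andP; split].
have notU v : v \in gverts g -> v \notin U.
  by rewrite (perm_mem perm_ord) => /(allP ordU).
pose f6 v := f v - (v == e) - (v == u1) - (v == u2) - (v == b) - (v == u4)
  - (v == u1) - (v == u4) - (v == u6).
have f6_out v : v \notin ord -> f6 v = f v - (v == e).
  rewrite /ord !inE !negb_or => /and5P[_ _ _ /negPf v6 /and4P[/negPf v4 /negPf vb /negPf v2 /negPf v1]].
  by rewrite /f6 v1 v2 v4 v6 vb !subn0.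
(* Eight subtractions of at most one each leave 2 of the margin 10 in [rd_new]. *)
have f6_new v : v \notin U -> c + 2 <= f6 v.
  move=> /new; rewrite /f6.
  repeat match goal with |- context [nat_of_bool ?b] =>
    move: (leq_b1 b); move: (nat_of_bool b) => ? end.
  by clear; lia.
have ordE v : (v \in [set z in gverts g] :|: U) = (v \in ord) || (v \in U).
  by rewrite in_setU inE (perm_mem perm_ord).
have ngv : {in gverts g, forall v, v \notin U}.
  by move=> v; rewrite (perm_mem perm_ord) => /(allP ordU).
have uE : uniq (gverts g) by rewrite (perm_uniq perm_ord).
exists g, f6; split=> //.
- by rewrite /gok /= u12 (adj_sym b) u2b bu4 u4p pq qu6 (adj_sym u6 a) au6
    (adj_sym u1 u6) u6u1 (adj_sym u6 q) qu6 (adj_sym q p) pq (adj_sym p u4) u4p u4a.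
split=> //.
- by rewrite gE; apply: g6.
- by move=> v; apply: leq_trans (le5 v); rewrite /f6 -subnDA; apply: leq_subr.
- move=> v; have [vU|/f6_new] := boolP (v \in U); last by clear; lia.
  rewrite f6_out; last by apply: contraTN vU => /(allP ordU).
  by case: eqP => [->|_]; rewrite ?subn0 // subn1 -ltnS prednK // (leq_ltn_trans _ en).
- by rewrite -[X in X <= _]addn1; apply: leq_trans (f6_new _ _); rewrite ?leq_add2l //; apply: ngv; rewrite /gverts !inE eqxx orbT.
- by rewrite ordE /ord !inE eqxx !orbT.
- move=> v; rewrite ordE negb_or => /andP[vo vU]; rewrite f6_out //.
  have -> : (v == e) = false by apply: contraNF vU => /eqP->.
  by rewrite subn0 new.
Qed.

Lemma ready_gadgets c d k U f e : ready c d U U f e -> M <= c ->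
    #|U| + 8 * k + 2 * M * d + 5 * M <= #|G| ->
  exists gs f', [/\ size gs = k, gchain e gs, all (fun g => size (gin g) == 4) gs,
    uniq (gall gs) /\ {in gall gs, forall v, v \notin U} &
    ready c d ([set v in gall gs] :|: U) ([set v in gall gs] :|: U) f' (gend e gs)].
Proof.
move=> rd leM; elim: k U f e rd => [|k IH] U f e rd room.
  exists [::], f; split=> //.
  by have -> : [set v in gall [::]] :|: U = U by apply/setP => v; rewrite !inE.
have [|g [f1 [eg ok sg [ug gU] rd1]]] := ready_gadget rd leM; first by clear -room; lia.
have cU : #|[set v in gverts g] :|: U| = 8 + #|U|.
  have := cardsUI [set v in gverts g] U.
  have -> : [set v in gverts g] :&: U = set0.
    by apply/setP => v; rewrite !inE; apply/negP => /andP[/gU/negP].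
  by rewrite cards0 addn0 => ->; rewrite cardsE (card_uniqP ug) /= sg.
have [|gs [f' [sgs ch al [ugs gsU] rd2]]] := IH _ _ _ rd1; first by rewrite cU; clear -room; lia.
have eS : [set v in gall (g :: gs)] :|: U = [set v in gall gs] :|: ([set v in gverts g] :|: U).
  by apply/setP => v; rewrite gall_cons !in_setU !in_set mem_cat [RHS]orbA [X in _ = X || _]orbC.
exists (g :: gs), f'; split; rewrite ?eS //; first by rewrite /= sgs.
- by rewrite /= eg ok.
- by rewrite /= sg eqxx.
split.
  rewrite gall_cons cat_uniq ug ugs andbT /=; apply/hasPn => v /gsU.
  by rewrite !inE negb_or => /andP[].
move=> v; rewrite gall_cons mem_cat => /orP[/gU//|/gsU].
by rewrite !inE negb_or => /andP[].
Qed.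

(** The targets [Zs] are in [U], so that no link uses them as inner vertices, but not in [P], so
    that their demands are still those of new vertices. Each target costs three vertices of the
    path. *)
Lemma ready_links c d Zs U P f e : ready c d U P f e -> M <= c ->
    uniq Zs -> {in Zs, forall z, z \in U /\ z \notin P} ->
    #|U| + 2 * size Zs + 2 * M * d + 5 * M <= #|G| ->
  exists pth f', [/\ path (@adj G) e pth, size pth = 3 * size Zs, {subset Zs <= pth},
    uniq pth /\ {in pth, forall v, v \in Zs \/ v \notin U} &
    ready c d ([set v in pth] :|: U) ([set v in pth] :|: P) f' (last e pth)].
Proof.
move=> rd leM; elim: Zs U P f e rd => [|z Zs IH] U P f e rd /= uZ ZU room.
  exists [::], f; split=> //.
  have e0 A : [set v in [::]] :|: A = A by apply/setP => v; rewrite !inE.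
  by rewrite !e0.
case/andP: uZ => zZs uZs.
have [zU zP] : z \in U /\ z \notin P by apply: ZU; rewrite inE eqxx.
have [|p [q [f1 [pt pU qU npq rd1]]]] := ready_link rd leM _ zU zP.
  by apply: leq_trans room; rewrite !leq_add2r leq_addr.
have cU : #|p |: (q |: U)| = #|U|.+2.
  by rewrite !cardsU1 in_setU1 negb_or npq pU qU.
have ZU' v : v \in Zs -> v \in U by move=> vZ; have [] := ZU v; rewrite ?inE ?vZ ?orbT.
have ZP' v : v \in Zs -> v \notin P by move=> vZ; have [] := ZU v; rewrite ?inE ?vZ ?orbT.
have [//|v vZ||pth [f' [pp sp sub [up pU'] rd2]]] := IH _ _ _ _ rd1.
- have vU := ZU' v vZ; rewrite !inE vU !orbT !negb_or ZP' // andbT; split=> //.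
  apply/and3P; split; first by apply: contraNneq zZs => <-.
    by apply: contraNneq pU => <-.
  by apply: contraNneq qU => <-.
- by apply: leq_trans room; rewrite !leq_add2r cU mulnS addnA addn2.
exists [:: p, q, z & pth], f'; split.
- by move: pt; rewrite /= => /and4P[-> -> -> _].
- by rewrite /= sp mulnS.
- by move=> v; rewrite !inE => /predU1P[->|/sub->]; rewrite ?eqxx ?orbT.
- have pthP v : v \in pth -> [/\ v != p, v != q & v != z].
    move=> /pU'[vZ|]; last first.
      rewrite !inE !negb_or => /and3P[-> -> vU]; split=> //.
      by apply: contraNneq vU => ->.
    have vU := ZU' v vZ; split; last by apply: contraNneq zZs => <-.
      by apply: contraNneq pU => <-.
    by apply: contraNneq qU => <-.
  split.
    rewrite /= !inE up andbT !negb_or npq /=; apply/and3P; split.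
    - apply/andP; split; first by apply: contraNneq pU => ->.
      by apply/negP => /pthP[]; rewrite eqxx.
    - apply/andP; split; first by apply: contraNneq qU => ->.
      by apply/negP => /pthP[]; rewrite eqxx.
    - by apply/negP => /pthP[]; rewrite eqxx.
  move=> v; rewrite !inE => /or4P[/eqP->|/eqP->|/eqP->|/pU'[->|]].
  - by right.
  - by right.
  - by left; rewrite eqxx.
  - by left; rewrite orbT.
  - by rewrite !inE !negb_or => /and3P[_ _]; right.
- have eU : [set v in [:: p, q, z & pth]] :|: U = [set v in pth] :|: (p |: (q |: U)).
    apply/setP => v; rewrite !inE; case: (eqVneq v z) => [->|_]; rewrite ?zU ?orbT //=.
    by do 4 (case: (_ \in _) || case: (_ == _); rewrite ?orbT //=).
  have eP : [set v in [:: p, q, z & pth]] :|: P = [set v in pth] :|: (z |: (p |: (q |: P))).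
    apply/setP => v; rewrite !inE.
    by case: (v == p) (v == q) (v == z) (v \in pth) => [] [] [] [].
  by rewrite eU eP.
Qed.

(** This pads the path to an exact length. *)
Lemma ready_tail c d k U P f e : ready c d U P f e ->
    #|U| + k + 2 * M * d + 3 * M <= #|G| ->
  exists pth f', [/\ path (@adj G) e pth, size pth = k,
    uniq pth /\ {in pth, forall v, v \notin U} &
    ready c d ([set v in pth] :|: U) ([set v in pth] :|: P) f' (last e pth)].
Proof.
elim: k U P f e => [|k IH] U P f e rd room.
  exists [::], f; split=> //.
  have e0 A : [set v in [::]] :|: A = A by apply/setP => v; rewrite !inE.
  by rewrite !e0.
have [|y [f1 [ey yU rd1]]] := ready_leaf rd; first by clear -room; lia.
have [|pth [f' [pp sp [up pU] rd2]]] := IH _ _ _ _ rd1.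
  by rewrite cardsU1 yU; clear -room; lia.
have eS A : [set v in y :: pth] :|: A = [set v in pth] :|: (y |: A).
  by apply/setP => v; rewrite !inE orbCA orbA.
exists (y :: pth), f'; rewrite !eS; split=> //=; first by rewrite ey.
- by rewrite sp.
split; first by rewrite up andbT; apply/negP => /pU; rewrite setU11.
by move=> v; rewrite inE => /predU1P[->//|/pU]; rewrite inE negb_or => /andP[].
Qed.

End Gadgets.

(** * Merging the cycles of a permutation of gadgets *)

Section GadgetPath.
Variables (G : sgraph) (I : finType) (g : I -> gadget G) (w : I -> G) (sigma : I -> I).
Hypothesis inj_sigma : injective sigma.
Hypothesis adj_aw : forall i, adj (ga (g i)) (w i).
Hypothesis adj_wb : forall i, adj (w i) (gb (g (sigma i))).

(** Starting next to [ga (g j)], it passes through [k] gadgets from [gb] to [ga], following [sigma],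
    and stops at [gb] of the next one. *)
Fixpoint walk k j : seq G :=
  w j :: gb (g (sigma j)) ::
  (if k is k'.+1 then gin (g (sigma j)) ++ ga (g (sigma j)) :: walk k' (sigma j)
   else [::]).

(** The representative of a cycle is crossed from [gu1] to [ga]; the walk then goes round the cycle
    and comes back to its [gb], which is adjacent to [gu2]. *)
Definition seg i : seq G :=
  if froot sigma i == i then
    gu1 (g i) :: rev (gin (g i)) ++ ga (g i) :: walk (order sigma i).-1 i ++ [:: gu2 (g i)]
  else [:: gu1 (g i); gu2 (g i)].

Let blk i := [:: gb (g i), ga (g i), w i & gin (g i)].

Lemma walk_path k j : (forall i, gok (g i)) -> path (@adj G) (ga (g j)) (walk k j).
Proof.
move=> ok; elim: k j => [|k IH] j /=; rewrite adj_aw adj_wb //=.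
have /and4P[_ _ pb _] := ok (sigma j).
by rewrite -cat_rcons cat_path pb last_rcons IH.
Qed.

Lemma last_walk k j x : last x (walk k j) = gb (g (iter k.+1 sigma j)).
Proof.
elim: k j x => [//|k IH] j x.
by rewrite [walk _ _]/= !last_cons last_cat last_cons IH -iterSr.
Qed.

(** The walk lacks [gin], [ga] and [gb] of its starting gadget and has an additional [gb] at its
    end. When it closes up, the two [gb] terms cancel. *)
Lemma count_walk (P : pred G) k j :
  count P (walk k j) + count P (gin (g j)) + P (ga (g j)) + P (gb (g j)) =
  \sum_(i <- traject sigma j k.+1) count P (blk i) + P (gb (g (iter k.+1 sigma j))).
Proof.
elim: k j => [|k IH] j.
  by rewrite /= big_seq1 /=; clear; lia.
have eW : count P (walk k.+1 j) = P (w j) + (P (gb (g (sigma j))) +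
    (count P (gin (g (sigma j))) + (P (ga (g (sigma j))) + count P (walk k (sigma j))))).
  by rewrite /= count_cat.
rewrite eW trajectS big_cons [count P (blk j)]/=.
by have := IH (sigma j); rewrite -iterSr; clear; lia.
Qed.

Lemma seg_path i (e : G) : (forall i, gok (g i)) -> adj e (gu1 (g i)) ->
  path (@adj G) e (seg i) /\ last e (seg i) = gu2 (g i).
Proof.
move=> ok eu; have /and4P[u12 bu _ pu] := ok i; rewrite /seg.
case: eqP => [root|_]; last by rewrite /= eu u12.
rewrite /= eu last_cat /= last_cat /=; split=> //.
rewrite -cat_rcons cat_path pu last_rcons cat_path walk_path //= andbT.
by rewrite last_walk prednK ?iter_order // order_gt0.
Qed.

Lemma count_seg (P : pred G) i :
  count P (seg i) = P (gu1 (g i)) + P (gu2 (g i)) +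
    (if froot sigma i == i then \sum_(j <- orbit sigma i) count P (blk j) else 0).
Proof.
rewrite /seg; case: eqP => [root|_]; last by rewrite /= !addn0.
have -> x y a k : count P (x :: rev (gin (g i)) ++ a :: walk k i ++ [:: y]) =
    P x + count P (gin (g i)) + P a + count P (walk k i) + P y.
  by rewrite /= count_cat count_rev /= count_cat /= addn0 !addnA.
have := count_walk P (order sigma i).-1 i.
by rewrite prednK ?order_gt0 // iter_order // -/(orbit sigma i); clear; lia.
Qed.

(** Since [froot] picks one representative in each cycle, the orbits of the representatives
    partition [I]. *)
Lemma sum_orbits (c : I -> nat) :
  \sum_(i | froot sigma i == i) \sum_(j <- orbit sigma i) c j = \sum_i c i.
Proof.
have sym := fconnect_sym inj_sigma.
rewrite [RHS](partition_big (froot sigma) (fun i => froot sigma i == i)) /=.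
  apply: eq_bigr => i /eqP ri; rewrite big_uniq ?orbit_uniq //=.
  apply: eq_bigl => j; rewrite -fconnect_orbit sym -(root_connect sym) ri.
  by [].
by move=> j _; rewrite (root_root sym).
Qed.

(* In each cycle of sigma exactly one gadget is crossed; this inserts the whole
   cycle into the path u1 u2 u1 u2 ... *)
Lemma gadget_path (e : G) : gchain e [seq g i | i <- enum I] -> exists L,
  [/\ path (@adj G) e L, last e L = gend e [seq g i | i <- enum I] &
      perm_eq L (gall [seq g i | i <- enum I] ++ [seq w i | i <- enum I])].
Proof.
move=> ch; exists (flatten [seq seg i | i <- enum I]).
have okI i : gok (g i).
  have : i \in enum I by rewrite mem_enum.
  elim: (enum I) (e) ch => //= j s IH e' /and3P[_ ok ch].
  by rewrite inE => /predU1P[->//|]; apply: IH ch.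
have [pp lp] : path (@adj G) e (flatten [seq seg i | i <- enum I]) /\
    last e (flatten [seq seg i | i <- enum I]) = gend e [seq g i | i <- enum I].
  elim: (enum I) (e) ch => [//|j s IH] e'.
  rewrite map_cons [gchain _ _]/= => /and3P[eu _ /IH[pp lp]].
  have [ps ls] := seg_path okI eu.
  by rewrite [flatten _]/= cat_path last_cat ps ls pp lp.
(* Both sequences are compared by counting an arbitrary predicate, which turns the rearrangement
   along cycles into [sum_orbits]. *)
split=> //; apply/permP => P.
rewrite count_cat /gall !count_flatten !sumnE !big_map.
rewrite -[X in _ = _ + X]sum1_count big_map [X in _ = _ + X]big_mkcond.
rewrite !big_enum /= -big_split /=.
rewrite (eq_bigr _ (fun i _ => count_seg P i)) big_split /=.
rewrite -big_mkcond sum_orbits -big_split /=; apply: eq_bigr => i _.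
by case: (P (w i)); clear; lia.
Qed.

End GadgetPath.

Lemma map_gall_sub (G : sgraph) (pk : gadget G -> G) (gs : seq (gadget G)) :
  (forall g, pk g \in gverts g) -> {subset map pk gs <= gall gs}.
Proof.
move=> pkP; elim: gs => // g gs IH v; rewrite gall_cons map_cons inE mem_cat.
by case/predU1P => [->|/IH->]; rewrite ?pkP ?orbT.
Qed.

Lemma uniq_gall (G : sgraph) (pk : gadget G -> G) (gs : seq (gadget G)) :
  (forall g, pk g \in gverts g) -> uniq (gall gs) -> uniq (map pk gs).
Proof.
move=> pkP; elim: gs => // g gs IH; rewrite gall_cons cat_uniq => /and3P[_ dis ug].
rewrite map_cons cons_uniq (IH ug) andbT; apply/negP => /(map_gall_sub pkP) gg.
by case/hasP: dis; exists (pk g).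
Qed.

Lemma size_gall (G : sgraph) (gs : seq (gadget G)) :
  all (fun g => size (gin g) == 4) gs -> size (gall gs) = 8 * size gs.
Proof.
elim: gs => // g gs IH; rewrite [all _ _]/= => /andP[/eqP sg /IH e].
by rewrite gall_cons size_cat e /= sg mulnS.
Qed.

(** * Spanning trees *)

Section SpanningTree.
Variables (G T : sgraph) (M Delta n R : nat).
Hypothesis R_def : R = M * Delta.
Hypotheses (M_gt0 : 0 < M) (Delta_gt0 : 0 < Delta) (jG : joined G M).
Hypotheses (cG : #|G| = n) (cT : #|T| = n) (treeT : is_tree T).
Hypothesis degT : max_degree T <= Delta.
Hypothesis n_large : (100 * R) ^ 2 <= n.
Hypothesis expand : forall X : {set G}, 0 < #|X| < M ->
  30 * R * #|X| <= #|set_neighbours X|.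

Notation nbG := (nbs (@neighbours G)).
Notation goodG := (good (@neighbours G) M).

Let leM : M <= R. Proof. by rewrite R_def leq_pmulr. Qed.
Let leD : Delta <= R. Proof. by rewrite R_def leq_pmull. Qed.
Let R0 : 0 < R. Proof. exact: leq_trans leM. Qed.
Let RR : R <= R * R. Proof. by rewrite leq_pmulr. Qed.
Let MM : M * R <= R * R. Proof. by rewrite leq_mul2r leM orbT. Qed.
Let nR : 100 * (100 * (R * R)) <= n.
Proof. by apply: leq_trans n_large; rewrite expnMn mulnA leq_mul. Qed.

(** While [X] without [Lf] is embedded, the vertices set aside for [Y], about a quarter of the graph
    or more, provide the room for large demands; [Y] then absorbs the exceptional vertices. *)
Lemma many_leaves_side (v : T) par h (X Y Lf : {set T}) :
    rooted v par h -> v \notin X -> v \notin Y -> [disjoint X & Y] ->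
    (forall x, x != v -> (x \in X) || (x \in Y)) ->
    {in X, forall x, par x \in X \/ par x = v} ->
    {in Y, forall x, par x \in Y \/ par x = v} ->
    Lf \subset X -> {in Lf, forall x, par x != v} ->
    (forall c, c != v -> par c \notin Lf) -> 8 * R <= #|Lf| ->
    n <= 4 * #|Y| + 8 ->
  contains_copy G T.
Proof.
move=> root vX vY dXY allXY clX clY sLf Lfv Lfc szLf szY.
have deg_le := card_children_deg degT root.
have szY2 : 24 * (100 * (R * R)) <= #|Y|.
  by clear -nR szY R0 RR; lia.
pose d := 8 * R.
have roomd : 2 * M * d + 5 * M + 20 * M <= #|Y|.
  by rewrite /d; clear -szY2 MM leM RR; lia.
have /card_gt0P[g0 _] : 0 < #|G| by rewrite cG; clear -nR RR leM M_gt0; lia.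
(* One [M] of the surplus will pay for the reserved exceptional vertices, the other for the stars of
   the links. *)
have emb0 : embedding M Delta v par d (M + M) [set v] (fun=> g0) set0 (fun=> d).
  apply: emb_start => //; first by rewrite /d; clear -leM leD M_gt0 Delta_gt0; lia.
  apply: (good_init M_gt0 jG expand); rewrite cards1; first by rewrite /d; clear -leM M_gt0; lia.
  by rewrite cG; apply: leq_trans nR; rewrite /d; clear -leM M_gt0 RR MM; lia.
have cXY : #|X| + #|Y| < n.
  have sub : X :|: Y \subset [set~ v].
    by apply/subsetP => x; rewrite !inE => /orP[]; apply: contraTneq => ->.
  have := subset_leq_card sub; have := cardsUI X Y.
  rewrite (disjoint_setI0 dXY) cards0 addn0 => -> le.
  apply: leq_ltn_trans le _; rewrite cardsC1 cT prednK //.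
  by rewrite -cT; apply/card_gt0P; exists v.
pose Sa := v |: (X :\: Lf).
have SaX : Sa \subset v |: X by apply: setUS; apply: subsetDl.
have cSa : #|Sa| + #|Y| <= n.
  have := subset_leq_card SaX; rewrite cardsU1 vX; clear -cXY; lia.
have clSa : {in Sa, forall x, x != v -> par x \in Sa}.
  move=> x; rewrite !inE => /predU1P[->|/andP[_ xX]] xv; first by rewrite eqxx in xv.
  by rewrite Lfc //; case: (clX x xX) => ->; rewrite ?eqxx ?orbT.
have [|||phi1 [f1 [_ emb1]]] := emb_grow M_gt0 jG root deg_le (S1 := Sa) emb0.
- by rewrite sub1set setU11.
- exact: clSa.
- by rewrite cG cards0; clear -roomd cSa; lia.
pose P1 := par @: Lf; pose A1 := phi1 @: P1.
have P1Sa : P1 \subset Sa.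
  apply/subsetP => _ /imsetP[x xL ->]; have xX := subsetP sLf x xL.
  have xv : x != v by apply: contraNneq vX => <-.
  rewrite !inE Lfc // andTb; case: (clX x xX) => [->|e]; first by rewrite orbT.
  by have := Lfv x xL; rewrite e eqxx.
(* Each parent has at most [Delta] children, so [8 * R] leaves have at least [8 * M] parents. *)
have cA1 : 3 * M <= #|A1|.
  rewrite card_in_imset; last by move=> x y /(subsetP P1Sa) xS /(subsetP P1Sa); apply: (emb_inj emb1).
  have sub : Lf \subset [set c | (c != v) && (par c \in P1)].
    apply/subsetP => x xL; rewrite inE imset_f // andbT.
    by apply: contraNneq vX => <-; apply: (subsetP sLf).
  have le1 := leq_trans szLf (subset_leq_card sub).
  have := leq_trans le1 (card_children_set deg_le P1).
  by rewrite R_def mulnA leq_pmul2r // => le; apply: leq_trans le; rewrite leq_mul2r orbT.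
have [Z cZ excZ] := exceptional_set M_gt0 jG cA1.
pose E := Z :\: phi1 @: Sa.
have cE : #|E| <= M by apply: leq_trans (ltnW cZ); apply/subset_leq_card/subsetDl.
have disE : [disjoint phi1 @: Sa & E].
  by rewrite disjoint_sym disjoints_subset; apply/subsetP => z; rewrite !inE => /andP[].
have emb2 := emb_reserve M_gt0 emb1 cE disE.
have SaY0 : Sa :&: Y = set0.
  apply/eqP; rewrite setI_eq0; apply: disjointWl SaX _.
  by rewrite -setI_eq0 setIUl (disjoint_setI0 dXY) setU0 setI_eq0 disjoints1.
have [|||S2 [phi2 [f2 [s12 s21 e2 im2 emb3]]]] :=
  emb_spots M_gt0 jG root deg_le (s := 3 * M) emb2 (leqnn M) vY clY.
- by rewrite cG; clear -roomd cSa cE; lia.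
- by rewrite SaY0 cards0 add0n leq_mul2l cE orbT.
- apply: leq_trans szY2.
  have DD : Delta * Delta <= R * Delta by rewrite leq_mul2r leD orbT.
  have DR : R * Delta <= R * R by rewrite leq_mul2l leD orbT.
  have MDD : M * (Delta * Delta) = R * Delta by rewrite R_def mulnA.
  have -> : (3 * M + 1) * (1 + Delta + Delta * Delta) =
      3 * M + 3 * (M * Delta) + 3 * (M * (Delta * Delta)) + 1 + Delta + Delta * Delta.
    by clear; nia.
  by rewrite MDD -R_def; clear -DD DR leM leD RR R0; lia.
have LfS2 : S2 \subset ~: Lf.
  apply: subset_trans s21 _; rewrite -disjoints_subset -setI_eq0 !setIUl.
  rewrite setDE setIAC -setIA setICr setI0 setU0.
  have -> : [set v] :&: Lf = set0.
    by apply/eqP; rewrite setI_eq0 disjoints1; apply: contra vX; apply: (subsetP sLf).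
  by rewrite set0U setI_eq0 disjoint_sym; apply: disjointWl sLf dXY.
have cLf := cardsC Lf; rewrite cT in cLf.
(* With demands cut to [Delta.+1], growth needs [2 * R + 5 * M] free vertices; the omitted leaves
   guarantee [8 * R]. *)
have [|||phi [f [eq3 emb]]] := emb_grow M_gt0 jG root deg_le (S1 := ~: Lf) (emb_cut deg_le emb3).
- exact: LfS2.
- by move=> x _ xv; rewrite inE Lfc.
- by rewrite cG cards0; rewrite mulnS -mulnA -R_def -cLf; clear -szLf leM; lia.
have eq1 : {in Sa, phi =1 phi1}.
  by move=> x xS; rewrite eq3 ?e2 // (subsetP s12).
pose W := ~: (phi @: ~: Lf).
have cW : #|W| = #|Lf|.
  have := cardsC (phi @: ~: Lf); rewrite -/W cG (card_in_imset (emb_inj emb)).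
  by clear -cLf; lia.
have SaC : Sa \subset ~: Lf := subset_trans s12 LfS2.
have a1E : A1 \subset (fun x => phi (par x)) @: Lf.
  apply/subsetP => _ /imsetP[_ /imsetP[x xL ->] ->]; apply/imsetP; exists x => //.
  by rewrite eq1 // (subsetP P1Sa) // imset_f.
have parLf x : x \in Lf -> par x \in ~: Lf.
  by move=> xL; apply: (subsetP SaC); apply: (subsetP P1Sa); apply: imset_f.
have [||||g injg gP] := hall_leftover M_gt0 jG (L := Lf) (a := fun x => phi (par x))
    (W := W) (f := f) g0 cW.
- by move=> x xL; rewrite inE negbK imset_f // parLf.
- by rewrite setCK; have := emb_good emb; rewrite setU0.
- move=> p; apply: leq_trans (emb_pend emb p); rewrite add0n; apply: subset_leq_card.
  by apply/subsetP => x; rewrite !inE negbK => /andP[xL ->]; rewrite xL -in_setC parLf.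
(* By now every vertex of [Z] is used, either in the first stage or as a spot in [Y], so [W] avoids
   [Z]. *)
- move=> B BW cB; apply: leq_trans (excZ B _ _ cB) _.
  + rewrite disjoints_subset; apply: subset_trans BW _; rewrite setCS.
    apply/subsetP => _ /imsetP[x xP ->]; have xS := subsetP P1Sa x xP.
    by rewrite -eq1 // imset_f // (subsetP SaC).
  + rewrite disjoints_subset; apply: subset_trans BW _; rewrite setCS.
    apply/subsetP => z zZ; have [/imsetP[x xS ->]|zS] := boolP (z \in phi1 @: Sa).
      by rewrite -eq1 // imset_f // (subsetP SaC).
    have /(subsetP im2)/imsetP[x xS ->] : z \in E by rewrite inE zS.
    by rewrite -eq3 // imset_f // (subsetP LfS2).
  + by apply: subset_leq_card; apply: setIS.
pose F x := if x \in Lf then g x else phi x.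
apply: (copy_of_rooted (F := F) root).
- move=> x y; rewrite /F; have [xL|xL] := boolP (x \in Lf); have [yL|yL] := boolP (y \in Lf).
  + exact: injg.
  + have [+ _] := gP x xL; rewrite inE => /negP gx e; case: gx.
    by rewrite e imset_f // inE.
  + have [+ _] := gP y yL; rewrite inE => /negP gy e; case: gy.
    by rewrite -e imset_f // inE.
  + by apply: (emb_inj emb); rewrite inE.
- move=> x xv; rewrite /F (negPf (Lfc x xv)); have [xL|xL] := boolP (x \in Lf).
    by have [_] := gP x xL; rewrite adj_sym.
  by apply: (emb_adj emb); rewrite ?inE.
Qed.

(** Both sides of the split are large enough to play the part of [Y], so the side with more leaves
    can be taken as [X]. *)
Lemma many_leaves : 20 * R <= #|leaves T| -> contains_copy G T.
Proof.
move=> szL.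
have [v [X [vX clX szX szX2]]] : exists (v : T) (X : {set T}), [/\ v \notin X,
    forall x y, x \in X -> adj x y -> y \in X \/ y = v,
    n <= 4 * #|X| & 2 * #|X| <= n].
  by apply: tree_split => //; clear -nR RR R0; lia.
have [par [h root]] := tree_rooted v treeT; have [parP hP edges] := root.
pose Y := ~: (v |: X).
have vY : v \notin Y by rewrite !inE eqxx.
have cY : #|X| + #|Y| + 1 = n.
  by have := cardsC (v |: X); rewrite cT -/Y cardsU1 vX; clear; lia.
have dXY : [disjoint X & Y].
  by rewrite disjoint_sym disjoints_subset setCS subsetUr.
have allXY x : x != v -> (x \in X) || (x \in Y).
  by move=> xv; rewrite !inE negb_or xv orbN.
have parX : {in X, forall x, par x \in X \/ par x = v}.
  move=> x xX; apply: (clX x _ xX); apply: parP.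
  by apply: contraNneq vX => <-.
have parY : {in Y, forall x, par x \in Y \/ par x = v}.
  move=> x xY; have xv : x != v by apply: contraNneq vY => <-.
  have [->|pv] := eqVneq (par x) v; [by right|left].
  have := allXY _ pv; case/orP => // pX; have := parP x xv; rewrite adj_sym => xp.
  have [xX|e] := clX _ _ pX xp; first by rewrite (disjointFr dXY xX) in xY.
  by rewrite e eqxx in xv.
have leafc x c : x != v -> x \in leaves T -> c != v -> par c != x.
  move=> xv; rewrite inE => lx cv; apply/eqP => e.
  have sub : [set par x; c] \subset neighbours x.
    by apply/subsetP => z; rewrite !inE => /orP[]/eqP->; rewrite ?parP // -e adj_sym parP.
  have := leq_trans (subset_leq_card sub) lx; rewrite cards2.
  have -> // : par x != c.
  apply/eqP => e'; have := hP x xv; have := hP c cv; rewrite e e'.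
  by move=> h1 h2; have := ltn_trans h1 h2; rewrite ltnn.
(* Dropping the children of [v] costs at most [Delta <= R] leaves. *)
pose Lf (B : {set T}) := (B :&: leaves T) :\: children v par v.
have side (B C : {set T}) : v \notin B -> v \notin C -> [disjoint B & C] ->
    (forall x, x != v -> (x \in B) || (x \in C)) ->
    {in B, forall x, par x \in B \/ par x = v} ->
    {in C, forall x, par x \in C \/ par x = v} ->
    10 * R <= #|B :&: leaves T| + 1 -> n <= 4 * #|C| + 8 -> contains_copy G T.
  move=> vB vC dBC allBC parB parC szB szC.
  have sLfB : Lf B \subset B by apply: subset_trans (subsetDl _ _) (subsetIl _ _).
  have nv x : x \in B -> x != v by move=> xB; apply: contraNneq vB => <-.
  apply: (many_leaves_side (Lf := Lf B) root vB vC dBC allBC parB parC sLfB) => //.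
  - move=> x; rewrite !inE => /andP[+ /andP[xB _]]; rewrite (nv x xB) /=.
    by [].
  - move=> c cv; apply/negP; rewrite !inE => /andP[_ /andP[pB pL]].
    by have := leafc (par c) c (nv _ pB); rewrite inE pL eqxx => /(_ isT cv).
  - have := cardsID (children v par v) (B :&: leaves T); rewrite -/(Lf B).
    have := subset_leq_card (subsetIr (B :&: leaves T) (children v par v)).
    have := card_children_deg degT root v.
    by clear -szB leD R0; lia.
have cL : #|leaves T| <= #|X :&: leaves T| + #|Y :&: leaves T| + 1.
  have sub : leaves T \subset v |: ((X :&: leaves T) :|: (Y :&: leaves T)).
    apply/subsetP => x xL; rewrite in_setU1; have [//|xv] := eqVneq x v.
    by rewrite in_setU !(in_setI x) xL !andbT allXY.
  apply: leq_trans (subset_leq_card sub) _; rewrite addnC.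
  apply: leq_trans (leq_card_setU _ _).1 _; rewrite cards1 leq_add2l.
  exact: (leq_card_setU _ _).1.
have [le|le] : 10 * R <= #|X :&: leaves T| + 1 \/ 10 * R <= #|Y :&: leaves T| + 1.
  by clear -cL szL; lia.
- by apply: (side X Y) => //; clear -cY szX2; lia.
- apply: (side Y X) => //; first by rewrite disjoint_sym.
    by move=> x /allXY; rewrite orbC.
  by clear -szX; lia.
Qed.

(** After the gadgets, the path runs through all vertices that are exceptional for the [ga] or for
    the [gb], so none is left outside. There are at most [2 * M] of them, three path vertices each,
    whence [6 * M <= k]. *)
Lemma skeleton k : 6 * M <= k <= 100 * R -> exists (s : G) gs pth,
  [/\ [/\ size gs = 9 * R, all (fun g => size (gin g) == 4) gs, gchain s gs,
          path (@adj G) (gend s gs) pth & size pth = k],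
      uniq (s :: gall gs ++ pth),
      goodG [set v in s :: gall gs ++ pth] (fun=> Delta.+2) &
      forall (pk : gadget G -> G) (Y : {set G}), pk = @ga G \/ pk = @gb G ->
        {in Y, forall v, v \notin s :: gall gs ++ pth} -> #|Y| <= M ->
        #|Y| <= #|nbG Y :&: [set v in map pk gs]| ].
Proof.
case/andP=> lek kle.
have /card_gt0P[s _] : 0 < #|G| by rewrite cG; clear -nR RR R0; lia.
pose d := 20 * R.
have roomd : 200 * R + 2 * M * d + 5 * M <= #|G|.
  by rewrite cG /d; clear -nR leM RR MM; lia.
have gd0 : goodG [set s] (fun=> d).
  apply: (good_init M_gt0 jG expand); rewrite cards1; rewrite /d; first by clear -R0; lia.
  by clear -roomd R0; rewrite /d in roomd; lia.
have rd0 : ready M (d - 10) d [set s] [set s] (fun=> d) s.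
  split=> //; rewrite ?inE ?eqxx ?subxx //; try by move=> v *; rewrite /d; clear -R0; lia.
  by rewrite /d; clear -R0; lia.
have [||gs [f1 [sgs ch al [ug gU] rd1]]] := ready_gadgets M_gt0 jG (k := 9 * R) rd0.
- by rewrite /d; clear -R0 leM; lia.
- by rewrite cards1; clear -roomd R0; lia.
set U1 := _ :|: [set s] in rd1.
have cU1 : #|U1| <= 72 * R + 1.
  apply: leq_trans (leq_card_setU _ _).1 _; rewrite cards1 leq_add2r cardsE.
  by apply: leq_trans (card_size _) _; rewrite size_gall // sgs; clear; lia.
have exc (pk : gadget G -> G) : (forall g, pk g \in gverts g) ->
    exists2 Z : {set G}, #|Z| < M & forall Y : {set G},
      [disjoint Y & [set v in map pk gs]] -> [disjoint Y & Z] ->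
      #|Y| <= M -> #|Y| <= #|nbG Y :&: [set v in map pk gs]|.
  move=> pkP; apply: exceptional_set => //.
  rewrite cardsE (card_uniqP (uniq_gall pkP ug)) size_map sgs.
  by clear -leM; lia.
have gaP (g : gadget G) : ga g \in gverts g by rewrite /gverts !inE eqxx !orbT.
have gbP (g : gadget G) : gb g \in gverts g by rewrite /gverts !inE eqxx !orbT.
have [ZA cA excA] := exc _ gaP; have [ZB cB excB] := exc _ gbP.
pose Z := (ZA :|: ZB) :\: U1.
have cZ : #|Z| <= 2 * M.
  apply: leq_trans (subset_leq_card (subsetDl _ _)) _.
  by apply: leq_trans (leq_card_setU _ _).1 _; clear -cA cB; lia.
(* Here [10] is the margin in [rd_new] and [2 * M] the price of reserving [Z]. *)
pose c := d - 10 - 2 * M.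
have c_ge : 8 * R <= c by rewrite /c /d; clear -R0 leM; lia.
have rd2 : ready M c d (U1 :|: Z) U1 (fun v => f1 v - 2 * M) (gend s gs).
  case: rd1 => g1 l1 ge1 en1 m1 _ n1; split=> //.
  - exact: good_reserve.
  - by move=> v; apply: leq_trans (l1 v); apply: leq_subr.
  - by move=> v; apply: leq_sub2r.
  - by rewrite /c; move: c_ge; rewrite /c; clear -en1 R0; lia.
  - exact: subsetUl.
  - move=> v /n1; move: c_ge; rewrite /c; clear -R0; lia.
have cUZ : #|U1 :|: Z| <= 72 * R + 1 + 2 * M.
  by apply: leq_trans (leq_card_setU _ _).1 _; apply: leq_add.
have sZ : size (enum Z) <= 2 * M by rewrite -cardE.
have [|||p1 [f2 [pp1 sp1 sub1 [up1 p1U] rd3]]] :=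
  ready_links M_gt0 jG rd2 _ (enum_uniq Z).
- by clear -c_ge leM; lia.
- by move=> z; rewrite mem_enum => zZ; rewrite inE zZ orbT; move: zZ; rewrite inE => /andP[].
- apply: leq_trans roomd; rewrite !leq_add2r.
  by apply: (leq_trans (leq_add cUZ (leq_mul (leqnn 2) sZ))); clear -R0 leM; lia.
have cU3 : #|[set v in p1] :|: (U1 :|: Z)| <= 72 * R + 1 + 2 * M + 6 * M.
  apply: leq_trans (leq_card_setU _ _).1 _; rewrite addnC leq_add // cardsE.
  by apply: leq_trans (card_size _) _; rewrite sp1; apply: (leq_trans (leq_mul (leqnn 3) sZ)); clear; lia.
have [|p2 [f3 [pp2 sp2 [up2 p2U] rd4]]] := ready_tail M_gt0 jG (k := k - 3 * size (enum Z)) rd3.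
  by clear -roomd cU3 leM kle R0; lia.
have U1E v : (v \in U1) = (v \in gall gs) || (v == s) by rewrite !inE.
exists s, gs, (p1 ++ p2); split.
- by split; rewrite ?cat_path ?pp1 // size_cat sp1 sp2 subnKC //; apply: leq_trans lek; apply: (leq_trans (leq_mul (leqnn 3) sZ)); clear; lia.
- rewrite /= !cat_uniq ug up1 up2 !mem_cat !negb_or /= andbT.
  have sU : s \in U1 by rewrite U1E eqxx orbT.
  have np1 v : v \in U1 -> v \notin p1.
    by move=> vU; apply/negP => /p1U[|]; [rewrite mem_enum in_setD vU|rewrite in_setU vU].
  have np2 v : (v \in U1) || (v \in p1) -> v \notin p2.
    move=> vU; apply/negP => /p2U; rewrite in_setU in_setU inE.
    by case/orP: vU => ->; rewrite ?orbT.
  rewrite np1 // np2 ?sU // !andbT; apply/and3P; split.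
  - by apply/negP => /gU; rewrite inE eqxx.
  - apply/hasPn => v; rewrite mem_cat => vp; apply/negP => vg.
    have vU : v \in U1 by rewrite U1E vg.
    by case/orP: vp; apply/negP; rewrite ?np1 ?np2 ?vU.
  - by apply/hasPn => v vp2; apply/negP => vp1; have := np2 v; rewrite vp1 orbT vp2 => /(_ isT).
- apply: good_mono (rd_good rd4).
    apply/subsetP => v; rewrite !inE !mem_cat => /or4P[->|->|->|->]; rewrite ?orbT //.
  by move=> v; apply: leq_trans (rd_ge rd4 v); clear -c_ge leD R0; lia.
move=> pk Y pkE YV cY.
have avoid (Z' : {set G}) : {subset Z' <= s :: gall gs ++ p1 ++ p2} -> [disjoint Y & Z'].
  move=> sub; rewrite -setI_eq0; apply/eqP/setP => v; rewrite !inE.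
  by apply/negP => /andP[/YV vV /sub]; rewrite (negPf vV).
have subZ : {subset ZA :|: ZB <= s :: gall gs ++ p1 ++ p2}.
  move=> v vZ; rewrite inE !mem_cat; have [|vU] := boolP (v \in U1).
    by rewrite U1E => /orP[]->; rewrite ?orbT.
  by rewrite (sub1 v) ?orbT // mem_enum inE vU.
have subP (pk' : gadget G -> G) : (forall g, pk' g \in gverts g) ->
    {subset [set v in map pk' gs] <= s :: gall gs ++ p1 ++ p2}.
  move=> pkP v; rewrite inE => /(map_gall_sub pkP) vg.
  by rewrite inE !mem_cat vg orbT.
have sA : {subset ZA <= s :: gall gs ++ p1 ++ p2}.
  by move=> v vZ; apply: subZ; rewrite inE vZ.
have sB : {subset ZB <= s :: gall gs ++ p1 ++ p2}.
  by move=> v vZ; apply: subZ; rewrite inE vZ orbT.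
by case: pkE => ->; [apply: excA|apply: excB] => //; apply: avoid => //; apply: subP.
Qed.

(** The skeleton has [1 + 72 * R + 19 * R] vertices, and [9 * R] vertices remain at the end, one for
    each gadget; together they carry the [100 * R + 1] vertices of the bare path. *)
Lemma few_leaves : #|leaves T| <= 20 * R -> contains_copy G T.
Proof.
move=> leL; pose K := 100 * R.
have [|r [par [h [y [root y0 yp ych]]]]] := bare_path (K := K) treeT cT leL.
  by rewrite /K; clear -nR R0; nia.
have [parP hP edges] := root; have deg_le := card_children_deg degT root.
have hinc i j : i < j -> j <= K -> h (y i) < h (y j).
  elim: j => // j IH; rewrite ltnS leq_eqVlt => /predU1P[->|ij] jK.
    by have [yr <-] := yp j jK; apply: hP.
  by apply: ltn_trans (IH ij (ltnW jK)) _; have [yr <-] := yp j jK; apply: hP.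
pose ys := mkseq y K.+1; pose Q := [set x in ys].
have uys : uniq ys.
  apply/mkseq_uniqP => i j; rewrite !inE !ltnS => iK jK e.
  by case: (ltngtP i j) => // lt; [have := hinc i j lt jK|have := hinc j i lt iK]; rewrite e ltnn.
have cQ : #|Q| = K.+1 by rewrite cardsE (card_uniqP uys) size_mkseq.
have yQ i : i <= K -> y i \in Q by move=> iK; rewrite inE; apply/mapP; exists i; rewrite ?mem_iota.
have QP x : x \in Q -> exists2 i, i <= K & x = y i.
  by rewrite inE => /mapP[i]; rewrite mem_iota /= ltnS => iK ->; exists i.
have [|s [gs [pth [[sgs al ch pp sp] uV gV back]]]] :=
    skeleton (k := 19 * R).
  by clear -leM; lia.
set VS := s :: gall gs ++ pth in uV gV back.
have szVS : size VS = 91 * R + 1.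
  by rewrite /VS /= size_cat size_gall // sgs sp; clear; lia.
pose t := last (gend s gs) pth.
pose U0 := [set v in VS].
have cU0 : #|U0| = 91 * R + 1 by rewrite cardsE (card_uniqP uV).
have tp : t \in pth.
  rewrite /t; case: (pth) sp => [|a p' _]; last by rewrite [last _ _]/= mem_last.
  by move=> /= e; clear -e R0; lia.
have st : s != t.
  by apply/eqP => e; move: uV; rewrite /VS /= mem_cat e tp orbT.
(* Only the ends of the bare path have children outside it, so the images of its inner vertices are
   placeholders. *)
pose phi0 x := if x == y K then t else s.
have K0 : 0 < K by rewrite /K muln_gt0.
have y0K : y 0 != y K by apply/eqP => e; have := hinc 0 K K0 (leqnn K); rewrite e ltnn.
have phi0s : phi0 (y 0) = s by rewrite /phi0 (negPf y0K).
have phi0t : phi0 (y K) = t by rewrite /phi0 eqxx.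
have ends c : c \notin Q -> c != r -> par c \in Q -> par c = y 0 \/ par c = y K.
  move=> cQ' cr /QP[i iK e].
  case: (posnP i) => [i0|i0]; first by left; rewrite e i0.
  case: (ltngtP i K) iK => // [lt _|eK _]; last by right; rewrite e eK.
  by case/negP: cQ'; rewrite (ych i c) ?i0 ?yQ.
have rQ : r \in Q by rewrite -y0 yQ.
have pend0 g : pend par Q phi0 g <= Delta.
  rewrite /pend; set P := [set c | _].
  have [->|[c]] := set_0Vmem P; first by rewrite cards0.
  rewrite inE => /and3P[cQ' pcQ /eqP ec]; apply: leq_trans (deg_le (par c)).
  have nr z : z \notin Q -> z != r by move=> zQ; apply: contraNneq zQ => ->.
  have inj a b : a = y 0 \/ a = y K -> b = y 0 \/ b = y K -> phi0 a = phi0 b -> a = b.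
    move=> [->|->] [->|->] //; rewrite phi0s phi0t => /eqP; first by rewrite (negPf st).
    by rewrite eq_sym (negPf st).
  apply: subset_leq_card; apply/subsetP => z; rewrite in_set => /and3P[zQ pzQ /eqP ez].
  rewrite inE nr //=; apply/eqP; apply: inj; last by rewrite ez.
    by apply: ends => //; apply: nr.
  by apply: ends => //; apply: nr.
(* The surplus [base := 1] keeps a unit of demand everywhere for the matchings of the [ga] and of
   the [gb]. *)
have [|||||phi [f [eq0 new inj gf [pe _ _]]]] :=
  grow M_gt0 jG root deg_le (base := 1) (phi0 := phi0) (S1 := setT) (erefl _)
    (subsetT Q) rQ _ _ gV (fun=> leqnn _).
- by move=> x _ _; rewrite inE.
- have sV : s \in VS by rewrite inE eqxx.
  have tV : t \in VS by rewrite /VS inE mem_cat tp !orbT.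
  by move=> x _; rewrite inE /phi0; case: ifP.
(* The [9 * R] vertices remaining are what [2 * M * Delta.+2 + 3 * M = 2 * R + 7 * M] asks for. *)
- have := cardsC Q; rewrite -setTD cT cQ -/U0 cU0 cG => e.
  by rewrite !mulnS -mulnA -R_def; move: e; rewrite /K; clear -leM; lia.
- by move=> g; rewrite -add1n -[Delta.+2]/(1 + Delta.+1) leq_add2l leqW.
- by move=> g _; rewrite add1n.
rewrite -/U0 in new gf.
pose U1 := U0 :|: phi @: (setT :\: Q); pose W := ~: U1; pose N := size gs.
have cU1 : #|U1| + N = n.
  have dis : U0 :&: phi @: (setT :\: Q) = set0.
    apply/eqP; rewrite setI_eq0 disjoint_sym disjoints_subset.
    apply/subsetP => _ /imsetP[x xQ ->]; rewrite inE.
    by have [] := new x xQ.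
  have := cardsUI U0 (phi @: (setT :\: Q)); rewrite dis cards0 addn0 -/U1 => ->.
  have := cardsC Q; rewrite -setTD cT cQ (card_in_imset inj) cU0 /N sgs /K.
  by clear; lia.
have cW : #|W| = #|[set: 'I_N]|.
  by have := cardsC U1; rewrite cardsT card_ord cG -/W -cU1 => /addnI.
pose g (i : 'I_N) := tnth (in_tuple gs) i.
have gsE : [seq g i | i <- enum 'I_N] = gs by apply: map_tnth_enum.
have ug : uniq (gall gs) by move: uV; rewrite /VS /= cat_uniq => /and4P[].
have gsub v : v \in gall gs -> v \notin W.
  by move=> vg; rewrite !inE negbK mem_cat vg orbT.
have match_ (pk : gadget G -> G) : pk = @ga G \/ pk = @gb G ->
    exists2 w : 'I_N -> G, injective w & forall i, w i \in W /\ adj (pk (g i)) (w i).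
  move=> pkE; have pkP : forall x, pk x \in gverts x.
    by move=> x; case: pkE => ->; rewrite /gverts !inE eqxx !orbT.
  have im : [set v in map pk gs] = (fun i => pk (g i)) @: [set: 'I_N].
    apply/setP => v; rewrite inE -gsE -map_comp; apply/mapP/imsetP => [][i _ ->]; exists i => //.
    by rewrite mem_enum.
  have injpk : injective (fun i => pk (g i)).
    apply/injectiveP; rewrite /dinjectiveb.
    by have := uniq_gall pkP ug; rewrite -{1}gsE -map_comp.
  have [||||w injw wP] := hall_leftover M_gt0 jG (L := [set: 'I_N]) (a := fun i => pk (g i))
      (W := W) (f := f) s cW.
  - by move=> i _; apply: gsub; apply: (map_gall_sub pkP); rewrite -gsE -map_comp; apply: map_f; rewrite mem_enum.
  - by rewrite setCK.
  - move=> p; apply: leq_trans (pe p).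
    apply: (@leq_trans 1); last by rewrite leq_addr.
    apply/card_le1_eqP => i j; rewrite !inE /= => /eqP ei /eqP ej.
    by apply: injpk; rewrite ei ej.
  - move=> Y YW cY; rewrite -im; apply: back => // v /(subsetP YW).
    by rewrite !inE negb_or => /andP[].
  exists w; first by move=> i j; apply: injw; rewrite inE.
  by move=> i; apply: wP; rewrite inE.
have [wa injwa waP] := match_ _ (or_introl erefl).
have [wb injwb wbP] := match_ _ (or_intror erefl).
have imb : wb @: [set: 'I_N] = W.
  apply/eqP; rewrite eqEcard card_imset // cW leqnn andbT.
  by apply/subsetP => _ /imsetP[i _ ->]; have [] := wbP i.
have ex i : {j | wb j = wa i}.
  have : wa i \in wb @: [set: 'I_N] by rewrite imb; have [] := waP i.
  case: (pickP (fun j => wb j == wa i)) => [j /eqP e _|no]; first by exists j.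
  by move=> H; exfalso; case/imsetP: H => j _ e; have := no j; rewrite e eqxx.
(* The [gb] of gadget [sigma i] is matched to the same leftover vertex as the [ga] of gadget [i]. *)
pose sigma i := sval (ex i).
have sigmaE i : wb (sigma i) = wa i := svalP (ex i).
have inj_sigma : injective sigma by move=> i j e; apply: injwa; rewrite -!sigmaE e.
have [|||L [pL lL permL]] := gadget_path (g := g) (w := wa) inj_sigma _ _ (e := s).
- by move=> i; have [] := waP i.
- by move=> i; rewrite -sigmaE adj_sym; have [] := wbP (sigma i).
- by rewrite gsE.
rewrite gsE in lL permL.
(* This path from [s] to [t] covers exactly [VS] and [W]; its vertices replace the placeholders. *)
pose H := s :: L ++ pth.
have pH : path (@adj G) s (L ++ pth) by rewrite cat_path pL lL.
have lH : last s (L ++ pth) = t by rewrite last_cat lL.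
have permH : perm_eq H (VS ++ [seq wa i | i <- enum 'I_N]).
  apply/permP => P; rewrite /H /VS /= !count_cat (permP permL) count_cat.
  by congr (_ + _); rewrite addnAC.
have waW i : wa i \in W by have [] := waP i.
have uH : uniq H.
  rewrite (perm_uniq permH) cat_uniq uV (map_inj_uniq injwa) enum_uniq andbT.
  apply/hasPn => _ /mapP[i _ ->]; apply/negP => wV; have := waW i.
  by rewrite in_setC in_setU in_set wV.
have szH : size H = K.+1.
  rewrite (perm_size permH) size_cat size_map -cardE card_ord szVS /N sgs /K.
  by clear; lia.
have HU v : v \in H -> (v \in U0) || (v \in W).
  rewrite (perm_mem permH) mem_cat => /orP[vV|/mapP[i _ ->]]; first by rewrite inE vV.
  by rewrite waW orbT.
pose F x := if x \in Q then nth s H (index x ys) else phi x.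
have Fy i : i <= K -> F (y i) = nth s H i.
  move=> iK; rewrite /F yQ //.
  by rewrite -[y i](@nth_mkseq _ r y K.+1 i) // index_uniq ?size_mkseq.
have notQ x : x \notin Q -> adj (phi x) (phi (par x)) /\ phi x \notin H.
  move=> xQ; have xD : x \in setT :\: Q by rewrite inE xQ inE.
  have [ax xU] := new x xD; split=> //; apply/negP => /HU; rewrite (negPf xU) /=.
  by rewrite !inE imset_f ?orbT.
have inH x : x \in Q -> F x \in H.
  by case/QP => i iK ->; rewrite Fy // mem_nth // szH.
apply: (copy_of_rooted (F := F) root).
- move=> x x' e; have [xQ|xQ] := boolP (x \in Q); have [x'Q|x'Q] := boolP (x' \in Q).
  + case/QP: xQ e => i iK ->; case/QP: x'Q => j jK ->; rewrite !Fy // => /eqP.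
    by rewrite nth_uniq ?szH // => /eqP->.
  + by have [_ /negP[]] := notQ x' x'Q; have := inH x xQ; rewrite e /F (negPf x'Q).
  + by have [_ /negP[]] := notQ x xQ; have := inH x' x'Q; rewrite -e /F (negPf xQ).
  + move: e; rewrite /F (negPf xQ) (negPf x'Q); apply: inj; by rewrite inE ?xQ ?x'Q inE.
- move=> x xr; have [xQ|xQ] := boolP (x \in Q).
    case/QP: xQ xr => -[|i] iK ->; first by rewrite y0 eqxx.
    move=> _; have [_ ->] := yp i iK; rewrite !Fy //; last exact: ltnW.
    have /pathP := pH; rewrite adj_sym /H => /(_ s i) /=; apply.
    by have := szH; rewrite /H /= => -[->].
  have [ax _] := notQ x xQ; rewrite {1}/F (negPf xQ).
  suff -> : F (par x) = phi (par x) by [].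
  have [pQ|pQ] := boolP (par x \in Q); last by rewrite /F (negPf pQ).
  case: (ends x xQ xr pQ) => ->; rewrite Fy // eq0 ?yQ //.
  rewrite phi0t -lH (last_nth s) /H /=; congr nth.
  by have := szH; rewrite /H /= => -[->].
Qed.

End SpanningTree.

(** * From expanders with real parameters to natural numbers *)

Lemma subset_of_size (T : finType) (A : {set T}) k : k <= #|A| ->
  exists2 B : {set T}, B \subset A & #|B| = k.
Proof.
move=> le; exists [set x in take k (enum A)].
  by apply/subsetP => x; rewrite inE => /mem_take; rewrite mem_enum.
rewrite cardsE (card_uniqP _) ?take_uniq ?enum_uniq //.
by rewrite size_takel // -cardE.
Qed.

Local Open Scope ring_scope.

(** Condition (ii) concerns sets of equal size, so both sets are first cut down to [M] vertices. *)
Lemma expander_joined (R : realType) n (d : R) (G : sgraph) (M : nat) :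
  is_expander n d G -> n%:R / (2 * d) <= M%:R -> joined G M.
Proof.
move=> [_ _ _ edges] leM X Y dXY /subset_of_size[X' sX cX] /subset_of_size[Y' sY cY].
have dis : [disjoint X' & Y'] by apply: disjointWl sX (disjointWr sY dXY).
have := edges X' Y' dis (etrans cX (esym cY)); rewrite cX => /(_ leM).
case/card_gt0P => -[x y]; rewrite !inE /= => /andP[/andP[xX yY] xy].
by exists x, y; rewrite (subsetP sX) // (subsetP sY).
Qed.

Theorem theorem1p10 (R : realType) :
  exists (C c : R) (n0 : nat),
    [/\ 0 < C, 0 < c &
      forall n Delta : nat, (n0 <= n)%N ->
        Delta%:R <= c * Num.sqrt (n%:R : R) ->
        forall G : sgraph,
          is_expander n (C * Delta%:R * Num.sqrt (n%:R : R)) G ->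
          tree_universal n Delta G].
Proof.
(* The value 0 for [n0] suffices: [0 < d] forces [Delta >= 1], and then the bound on [Delta] gives a
   square root of at least 100. *)
exists 100, (100^-1), 0; split=> //; first by rewrite invr_gt0.
move=> n Delta _ leD G expG T [treeT cT degT].
set s := Num.sqrt _ in leD expG; set d := _ * s in expG.
have [d_gt0 cG small _] := expG.
have s2 : s * s = n%:R by rewrite -expr2 sqr_sqrtr ?ler0n.
have s_ge0 : 0 <= s by apply: sqrtr_ge0.
have D_gt0 : (0 < Delta)%N.
  by case: posnP d_gt0 => // e; rewrite /d e mulr0 mul0r ltxx.
have s_gt0 : 0 < s.
  rewrite lt_def s_ge0 andbT; apply/eqP => e.
  by rewrite /d e mulr0 ltxx in d_gt0.
have DR_gt0 : 0 < Delta%:R :> R by rewrite ltr0n.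
pose x : R := n%:R / (2 * d).
have xE : x * (200 * Delta%:R) = s.
  rewrite /x -s2 /d; field.
  by rewrite !gt_eqF.
have x_gt0 : 0 < x.
  by rewrite -(pmulr_lgt0 _ (_ : 0 < 200 * Delta%:R)) ?xE // mulr_gt0.
have ex : exists m : nat, x <= m%:R by exists (Num.truncn x).+1; apply/ltW/truncnS_gt.
have [M leM minM] := ex_minnP ex.
have M_gt0 : (0 < M)%N by rewrite -(ltr0n R); apply: lt_le_trans leM.
have below k : (k < M)%N -> k%:R < x.
  by move=> ltk; rewrite ltNge; apply/negP => /minM; rewrite leqNgt ltk.
(* For [M = 1] this is the bound on [Delta]. Otherwise [M <= 2 * (M - 1) < 2 * x], where [x] is
   [s / (200 * Delta)]. *)
have le_s : 100 * (M%:R * Delta%:R) <= s.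
  case: M leM minM M_gt0 below => // -[|M] leM minM _ below.
    by rewrite mul1r mulrC -ler_pdivlMr // mulrC.
  have lt : M.+1%:R * (200 * Delta%:R) < s.
    by rewrite -xE ltr_pM2r ?below // mulr_gt0.
  have le2 : M.+2%:R <= 2 * M.+1%:R :> R by rewrite -natrM ler_nat; clear; lia.
  have := ler_wpM2r (ltW DR_gt0) le2; move: lt; clear; lra.
have n_large : ((100 * (M * Delta)) ^ 2 <= n)%N.
  rewrite -(ler_nat R) -s2 natrX !natrM expr2.
  by apply: ler_pM => //; rewrite !mulr_ge0 ?ler0n.
have expand (X : {set G}) : (0 < #|X| < M)%N ->
    (30 * (M * Delta) * #|X| <= #|set_neighbours X|)%N.
  case/andP=> X0 XM; rewrite -(ler_nat R).
  apply: le_trans (small X X0 (below _ XM)); rewrite !natrM ler_wpM2r //.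
  have D1 : 1 <= Delta%:R :> R by rewrite ler1n.
  (* The square root [s] lies between [30 * M * Delta] and [d]. *)
  apply: (@le_trans _ _ s); first by move: le_s s_gt0; nra.
  by rewrite /d; move: D1 s_gt0; clear; nra.
have jG := expander_joined expG leM.
have [le|/ltnW le] := leqP (20 * (M * Delta)) #|leaves T|.
  exact: (many_leaves erefl M_gt0 D_gt0 jG cG cT treeT degT n_large expand).
exact: (few_leaves erefl M_gt0 D_gt0 jG cG cT treeT degT n_large expand).
Qed.
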